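(* Let $H=\{P_1',\ldots,P_t'\}$ be a disjoint union of paths and let $K_m$ be a complete graph on $m$ vertices such that: (a) for any $i$, if $K_m\cap P_i'\neq\emptyset$, then $V(K_m)\cap V(P_i')=\{v_i\}$ for some vertex $v_i$ which is a free vertex of $P_i'$; (b) $V(K_m)\cap V(P_i')\cap V(P_j')=\emptyset$ for all distinct $i$ and $j$. Let $n$ be the number of edges of $H$, and let $S$ be the polynomial ring over a field $k$ in the variables $x_v,y_v$, where $v$ ranges over the vertices of $H\cup K_m$. Then, for any $n\ge 1$ and any $m\ge 2$, $$\operatorname{reg}\frac{S}{J_HJ_{K_m}}=2+n.$$
   Context: For a finite simple graph $\Gamma$ whose vertices lie in the vertex set indexing the variables of $S$, the binomial edge ideal $J_\Gamma\subset S$ is the ideal generated by the edge binomials $x_uy_v-x_vy_u$, for $\{u,v\}$ an edge of $\Gamma$. $J_HJ_{K_m}$ is the product ideal. A vertex of a graph is free if it is contained in only one maximal clique; in a path with at least one edge the free vertices are the two end vertices. $S$ is standard graded and $\operatorname{reg}$ is the Castelnuovo-Mumford regularity over $S$. *)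

(* Defs.v *)
From HB Require Import structures.
From mathcomp Require Import all_boot all_order all_algebra.
From mathcomp Require Export mpoly.

Set Implicit Arguments.
Unset Strict Implicit.
Unset Printing Implicit Defensive.

Import GRing.Theory.

Local Open Scope ring_scope.

(* Several graphs, with different and possibly overlapping vertex sets, live
   in the same ambient finite type V. *)
Record sgraph (V : finType) := SGraph {
  vert : {set V};
  adj : rel V;
  adj_sym : ssrbool.symmetric adj;
  adj_irr : irreflexive adj;
  adj_vert : forall u v, adj u v -> u \in vert
}.

Section Graphs.
Variable V : finType.
Implicit Types (G : sgraph V) (C : {set V}).

Definition edges G : {set {set V}} :=
  [set [set e.1; e.2] | e in [pred e : V * V | adj G e.1 e.2]].

Definition clique G C : bool :=
  (C \subset vert G) &&
  [forall u in C, forall v in C, (u != v) ==> adj G u v].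

Definition free_vertex G (v : V) : bool :=
  #|[set C | maxset (clique G) C & v \in C]| == 1%N.

(* The path with r edges; r = 0 gives an isolated vertex. *)
Definition is_path G : Prop :=
  exists r (f : 'I_r.+1 -> V),
    [/\ injective f,
        vert G = [set f i | i : 'I_r.+1]
      & forall i j : 'I_r.+1,
          adj G (f i) (f j) = (i.+1 == j :> nat) || (j.+1 == i :> nat)].

Definition is_complete (m : nat) G : Prop :=
  #|vert G| = m /\ {in vert G &, forall u v, adj G u v = (u != v)}.

Section Union.
Variables (t : nat) (P : 'I_t -> sgraph V).

Definition union_adj : rel V := fun u v => [exists i, adj (P i) u v].

Lemma union_adj_sym : ssrbool.symmetric union_adj.
Proof. by move=> u v; apply: eq_existsb => i; apply: adj_sym. Qed.

Lemma union_adj_irr : irreflexive union_adj.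
Proof. by move=> u; apply/existsP => -[i]; rewrite adj_irr. Qed.

Lemma union_adj_vert u v : union_adj u v -> u \in \bigcup_i vert (P i).
Proof. by case/existsP=> i uv; apply/bigcupP; exists i => //; apply: adj_vert uv. Qed.

Definition graph_union : sgraph V :=
  SGraph union_adj_sym union_adj_irr union_adj_vert.
End Union.
End Graphs.

Section Ideals.
Variables (k : fieldType) (N : nat).
Local Notation S := {mpoly k[N]}.
Implicit Types (I J B : S -> Prop).

Definition ideal_span B : S -> Prop := fun p =>
  exists r (c g : 'I_r -> S), (forall i, B (g i)) /\ p = \sum_i c i * g i.

Definition ideal_mul I J : S -> Prop :=
  ideal_span (fun p => exists a b, [/\ I a, J b & p = a * b]).

(* A graded free resolution of S/I, with F_i the direct sum of the S(-j) for j
   in the family [shift i]; elements of F_i are row vectors and maps act by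
   right multiplication. The augmentation F_0 -> S/I is given by homogeneous
   representatives in S of the images of the basis elements. *)
Record graded_resolution I := GradedResolution {
  rk : nat -> nat;
  shift : forall i, 'I_(rk i) -> nat;
  aug : 'cV[S]_(rk 0);
  diff : forall i, 'M[S]_(rk i.+1, rk i);
  aug_homog : forall a, aug a ord0 \is (@shift 0%N a).-homog;
  diff_homog : forall i a b, diff i a b != 0 ->
    (shift b <= shift a)%N /\ diff i a b \is (shift a - shift b)%N.-homog;
  aug_surj : forall p : S, exists v : 'rV[S]_(rk 0),
    I (p - (v *m aug) ord0 ord0);
  aug_exact : forall v : 'rV[S]_(rk 0),
    I ((v *m aug) ord0 ord0) <-> exists w, v = w *m diff 0;
  diff_exact : forall i (v : 'rV[S]_(rk i.+1)),
    v *m diff i = 0 <-> exists w, v = w *m diff i.+1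
}.

(* All entries of the differentials lie in the irrelevant maximal ideal. *)
Definition minimal_resolution I (F : graded_resolution I) : Prop :=
  forall i a b, (diff F i a b)@_0%MM = 0.

(* reg(S/I) = r, that is, r is the maximum of j - i over all i, j with
   beta_{i,j}(S/I) != 0, the Betti number beta_{i,j} being the number of
   summands S(-j) of F_i in a minimal graded free resolution F. Such an F is
   unique up to isomorphism, so at most one r qualifies. *)
Definition regularity_quotient I (r : nat) : Prop :=
  exists F : graded_resolution I,
    [/\ minimal_resolution F,
        forall i (a : 'I_(rk F i)), (shift a <= r + i)%N
      & exists i (a : 'I_(rk F i)), shift a = (r + i)%N].
End Ideals.

Section BinomialEdgeIdeal.
Variables (k : fieldType) (V : finType).

Definition xvar (v : V) : {mpoly k[#|V| + #|V|]} := 'X_(lshift #|V| (enum_rank v)).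
Definition yvar (v : V) : {mpoly k[#|V| + #|V|]} := 'X_(rshift #|V| (enum_rank v)).

Definition binomial_edge_ideal (G : sgraph V) : {mpoly k[#|V| + #|V|]} -> Prop :=
  ideal_span (fun p => exists u v,
    adj G u v /\ p = xvar u * yvar v - xvar v * yvar u).
End BinomialEdgeIdeal.

Arguments binomial_edge_ideal k {V} G.

(* Main.v *)
(* Let [J] be the ideal of the complete graph and let [f_1, ..., f_n] be the
   edge binomials of the paths, listed outwards from the complete graph. Each new
   edge joins a new vertex to a free vertex of the graph built so far. Modulo the
   binomial edge ideal of a graph, the variable [x_z] of a free vertex [z] is
   regular, and hence so is the new binomial. So the [f_i] form a regular
   sequence both on [S] and on [S/J]; thus they are regular on [J], and the
   product ideal is [J] meet [(f_1, ..., f_n)]. As [J] has a linear resolution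
   [G], the product is resolved by the tensor product of [G] with the truncated
   Koszul complex on the [f_i], an iterated mapping cone of multiplications by
   the [f_i] whose entries all have positive degree. *)

(* The intersection of J with the ideal F of the edges used so far does not determine its own
   successor, so a second module is carried along. Let U be this intersection and T the rows [w]
   with [w *m G] in U. Adjoining an edge binomial f turns U into U + f J, and T into T plus f times
   the whole free module. In both cases the coefficient rows that f sends into the old module form T
   again, because f is regular modulo F. So the pair (U, T) reproduces itself.

   The constant: T starts as the syzygies of [G], linear from degree 3. Each cone shifts T by two
   degrees and by one homological step, so the extremal corner rises by one with each edge; the
   first edge creates generators f J of degree 4, which already gives regularity 3 for the quotient.

   Betti numbers are never counted. In a minimal resolution nothing cancels, so it is enough to know
   which degrees occur: an upper bound and one pair that attains it. *)
From HB Require Import structures.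
Require Import Defs.
From mathcomp Require Import all_boot all_order all_algebra.
From mathcomp Require Import ring zify.

Set Implicit Arguments.
Unset Strict Implicit.
Unset Printing Implicit Defensive.

Import GRing.Theory.

Local Open Scope ring_scope.

(** * Graded resolutions *)

Section Resolutions.
Variables (k : fieldType) (N : nat).
Local Notation S := {mpoly k[N]}.

(* [p] is homogeneous of degree [d - s], as an entry at a generator of degree
   [s] in an element of degree [d]; it vanishes when [d < s]. *)
Definition hdeg (s d : nat) (p : S) : Prop :=
  forall m, m \in msupp p -> (mdeg m + s)%N = d.

Lemma hdeg0 s d : hdeg s d 0.
Proof. by move=> m; rewrite msupp0. Qed.

Lemma hdegD s d p q : hdeg s d p -> hdeg s d q -> hdeg s d (p + q).
Proof.
by move=> hp hq m /msuppD_le; rewrite mem_cat => /orP [/hp | /hq].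
Qed.

Lemma hdegN s d p : hdeg s d p -> hdeg s d (- p).
Proof. by move=> hp m; rewrite (perm_mem (msuppN p)) => /hp. Qed.

Lemma hdeg_sum (I : Type) (r : seq I) (P : pred I) (F : I -> S) s d :
  (forall i, P i -> hdeg s d (F i)) -> hdeg s d (\sum_(i <- r | P i) F i).
Proof.
move=> h; elim/big_rec: _ => [|i p Pi hp]; first exact: hdeg0.
by apply: hdegD => //; apply: h.
Qed.

Lemma hdegM s t d p q : hdeg t d p -> hdeg s t q -> hdeg s d (p * q).
Proof.
move=> hp hq m /msuppM_le /allpairsP [[m1 m2] /= [/hp h1 /hq h2 ->]].
by rewrite mdegD -addnA h2.
Qed.

Lemma hdeg_addl s d e p : hdeg s d p -> hdeg (e + s) (e + d) p.
Proof. by move=> h m /h <-; rewrite addnCA. Qed.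

Lemma hdegX s m : hdeg s (mdeg m + s) 'X_[m].
Proof. by move=> m'; rewrite msuppX inE => /eqP ->. Qed.

Lemma hdegC (c : k) d : hdeg d d c%:MP.
Proof. by move=> m; rewrite msuppC; case: eqP => // _; rewrite inE => /eqP ->; rewrite mdeg0. Qed.

Lemma hdeg_coef0 s d p : hdeg s d p -> (s != d)%N -> p@_0%MM = 0.
Proof.
move=> hp sd; apply: memN_msupp_eq0; apply/negP => /hp; rewrite mdeg0 add0n.
by move/eqP; rewrite (negbTE sd).
Qed.

Lemma hdeg_homog s d p : hdeg s d p -> p != 0 ->
  (s <= d)%N /\ p \is (d - s)%N.-homog.
Proof.
move=> hp p0; split; last by apply/dhomogP => m /hp <-; rewrite addnK.
by rewrite -(hp _ (mlead_supp p0)) leq_addl.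
Qed.

Definition hcomp (s d : nat) (p : S) : S :=
  if (s <= d)%N then pihomog mdeg (d - s) p else 0.

Lemma hcompP s d p : hdeg s d (hcomp s d p).
Proof.
rewrite /hcomp; case: leqP => sd; last exact: hdeg0.
by move=> m /(dhomog_mf (pihomogP mdeg (d - s) p)) ->; rewrite subnK.
Qed.

Lemma hcompD s d p q : hcomp s d (p + q) = hcomp s d p + hcomp s d q.
Proof. by rewrite /hcomp; case: ifP => _; rewrite ?addr0 // pihomogD. Qed.

Lemma hcomp_sum (I : Type) (r : seq I) (P : pred I) (F : I -> S) s d :
  hcomp s d (\sum_(i <- r | P i) F i) = \sum_(i <- r | P i) hcomp s d (F i).
Proof.
apply: (big_morph _ (hcompD s d)).
by rewrite /hcomp; case: ifP => // _; rewrite pihomog0.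
Qed.

Lemma hcomp_hdeg s d e p :
  hdeg s e p -> hcomp s d p = if e == d then p else 0.
Proof.
move=> hp; rewrite /hcomp pihomogE big_seq_cond.
case: eqP => [<-|ed].
  case: leqP => es.
    rewrite [RHS]mpolyE [RHS]big_seq; apply: eq_bigl => m.
    by case: (boolP (m \in _)) => //= /hp <-; rewrite addnK eqxx.
  apply/esym/eqP; apply: contraTT es => p0; rewrite -leqNgt.
  by case: (hdeg_homog hp p0).
case: leqP => sd //; rewrite big_pred0 // => m; apply/negP => /andP [/hp h /eqP h2].
by apply: ed; rewrite -h h2 subnK.
Qed.

Lemma hcompM s t d p q : hdeg s t q -> hcomp s d (p * q) = hcomp t d p * q.
Proof.
move=> hq; rewrite [p]mpolyE mulr_suml !hcomp_sum mulr_suml.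
apply: eq_bigr => m _.
have hm : hdeg t (mdeg m + t) (p@_m *: 'X_[m]).
  by move=> m' /msuppZ_le /hdegX; apply.
rewrite (hcomp_hdeg _ hm) (hcomp_hdeg _ (hdegM hm hq)).
by case: ifP => _ //; rewrite mul0r.
Qed.

Definition hrow b (s : 'I_b -> nat) d (v : 'rV[S]_b) : Prop :=
  forall j, hdeg (s j) d (v ord0 j).

Definition hmx a b (s' : 'I_a -> nat) (s : 'I_b -> nat) (D : 'M[S]_(a, b)) :=
  forall i j, hdeg (s j) (s' i) (D i j).

Lemma hmx_row a b s' s (D : 'M[S]_(a, b)) i :
  hmx s' s D -> hrow s (s' i) (row i D).
Proof. by move=> h j; rewrite mxE. Qed.

Lemma hrow_mul a b s' s d (D : 'M[S]_(a, b)) v :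
  hmx s' s D -> hrow s' d v -> hrow s d (v *m D).
Proof.
move=> hD hv j; rewrite mxE; apply: hdeg_sum => i _.
exact: hdegM (hv i) (hD i j).
Qed.

(** Taking in each entry of a preimage the component of the right degree does not change the image,
    because [v] and the entries of [D] are homogeneous. So lifts can be chosen homogeneous. *)
Lemma hrow_lift a b s' s d (D : 'M[S]_(a, b)) v :
  hmx s' s D -> hrow s d v -> (exists w, v = w *m D) ->
  exists2 w, hrow s' d w & v = w *m D.
Proof.
move=> hD hv [w Ev]; exists (\row_i hcomp (s' i) d (w ord0 i)).
  by move=> i; rewrite mxE; apply: hcompP.
apply/rowP => j; have := hcomp_hdeg d (hv j); rewrite eqxx => <-.
rewrite Ev !mxE hcomp_sum; apply: eq_bigr => i _.
by rewrite (hcompM _ _ (hD i j)) mxE.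
Qed.

Lemma hmx_lift a b c s1 s2 s3 (D : 'M[S]_(a, c)) (E : 'M[S]_(b, c)) :
  hmx s1 s3 D -> hmx s2 s3 E ->
  (forall w : 'rV[S]_a, exists u, w *m D = u *m E) ->
  exists2 L, hmx s1 s2 L & D = L *m E.
Proof.
move=> hD hE lift.
have /fin_all_exists [L LP] : forall i, exists w : 'rV[S]_b,
    hrow s2 (s1 i) w /\ row i D = w *m E.
  move=> i; have [|w hw Ew] := hrow_lift hE (@hmx_row _ _ _ _ _ i hD).
    by have [u Eu] := lift (delta_mx 0 i); exists u; rewrite rowE.
  by exists w.
exists (\matrix_i L i).
  by move=> i j; rewrite mxE; case: (LP i).
by apply/row_matrixP => i; rewrite row_mul rowK; case: (LP i).
Qed.

(* A graded free resolution of length [l] of a submodule [Z] of a free module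
   whose basis has degrees [s]; [beta i j] tells whether its [i]-th module has
   a basis element of degree [j], and [mn] whether it has to be minimal. *)
Fixpoint resolution (mn : bool) l b (s : 'I_b -> nat) (Z : 'rV[S]_b -> Prop)
    (beta : nat -> nat -> Prop) {struct l} : Prop :=
  if l is l'.+1 then
    exists a (s' : 'I_a -> nat) (D : 'M[S]_(a, b)),
    [/\ hmx s' s D, mn -> forall i j, (D i j)@_0%MM = 0,
        forall v, Z v <-> exists w, v = w *m D,
        forall j, beta 0%N j <-> exists i, s' i = j
      & resolution mn l' s' (fun w => w *m D = 0) (fun i => beta i.+1)]
  else (forall v, Z v <-> v = 0) /\ forall i j, ~ beta i j.

Lemma resolution_ext mn l b (s s2 : 'I_b -> nat) Z Z2 beta beta2 :
  s =1 s2 -> (forall v, Z v <-> Z2 v) -> (forall i j, beta i j <-> beta2 i j) ->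
  resolution mn l s Z beta -> resolution mn l s2 Z2 beta2.
Proof.
elim: l b s s2 Z Z2 beta beta2 => [|l IH] b s s2 Z Z2 beta beta2 Es EZ Eb /=.
  by case=> hZ hb; split=> [v | i j /Eb /hb]; rewrite -?EZ.
case=> a [s' [D [hD mD ZD bD rD]]]; exists a, s', D; split=> //.
- by move=> i j; rewrite -Es.
- by move=> v; rewrite -EZ.
- by move=> j; rewrite -Eb.
- by apply: IH rD => // i j; apply: Eb.
Qed.

Lemma resolutionS mn l b (s : 'I_b -> nat) Z beta :
  resolution mn l s Z beta -> resolution mn l.+1 s Z beta.
Proof.
elim: l b s Z beta => [|l IH] b s Z beta.
  case=> hZ hb; exists 0, (fun=> 0%N), 0; split=> //.
  - by case.
  - by move=> _; case.
  - by move=> v; rewrite hZ; split=> [->|[w ->]]; [exists 0|]; rewrite mulmx0.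
  - by move=> j; split=> [/hb|[[]]].
  - split=> [v|i j /hb //]; split=> _; first by apply/rowP; case.
    by rewrite mulmx0.
case=> a [s' [D [hD mD ZD bD rD]]]; exists a, s', D; split=> //.
exact: IH.
Qed.

Lemma resolution_leq mn l l' b (s : 'I_b -> nat) Z beta : (l <= l')%N ->
  resolution mn l s Z beta -> resolution mn l' s Z beta.
Proof.
move/subnK <-; elim: (l' - l)%N => // n IH /IH; rewrite addSn.
exact: resolutionS.
Qed.

Lemma resolution_shift mn l e b (s : 'I_b -> nat) Z beta :
  resolution mn l s Z beta ->
  resolution mn l (fun i => e + s i)%N Z
    (fun i j => exists2 j', beta i j' & j = (e + j')%N).
Proof.
elim: l b s Z beta => [|l IH] b s Z beta.
  by case=> hZ hb; split=> // i j [j' /hb].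
case=> a [s' [D [hD mD ZD bD rD]]]; exists a, (fun i => e + s' i)%N, D; split=> //.
- by move=> i j; apply: hdeg_addl.
- move=> j; split=> [[j' /bD [i <-] ->] | [i <-]]; first by exists i.
  by exists (s' i) => //; apply/bD; exists i.
- exact: IH rD.
Qed.

(** The entries of a linear resolution have degree one, hence no constant term. Minimality can thus
    be ignored while the resolution of the complete graph is built. *)
Lemma resolution_linear_minimal l c b (s : 'I_b -> nat) Z beta :
  (forall i, s i = c) -> (forall i j, beta i j -> j = (i + c.+1)%N) ->
  resolution false l s Z beta -> resolution true l s Z beta.
Proof.
elim: l c b s Z beta => [|l IH] c b s Z beta hs hb //.
case=> a [s' [D [hD mD ZD bD rD]]]; exists a, s', D.
have hs' i : s' i = c.+1 by apply: (hb 0%N); apply/bD; exists i.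
split=> //.
- move=> _ i j; apply: (hdeg_coef0 (hD i j)).
  by rewrite hs hs' neq_ltn ltnSn.
- by apply: (IH c.+1) rD => // i j /hb ->; rewrite addSnnS.
Qed.

Definition shift_cat a b (sA : 'I_a -> nat) (sB : 'I_b -> nat) (i : 'I_(a + b)) :=
  match split i with inl i => sA i | inr i => sB i end.

Lemma shift_catl a b sA sB i : @shift_cat a b sA sB (lshift b i) = sA i.
Proof. by rewrite /shift_cat (unsplitK (inl i)). Qed.

Lemma shift_catr a b sA sB i : @shift_cat a b sA sB (rshift a i) = sB i.
Proof. by rewrite /shift_cat (unsplitK (inr i)). Qed.

Lemma hmx_col a b c sA sB s (A : 'M[S]_(a, c)) (B : 'M[S]_(b, c)) :
  hmx sA s A -> hmx sB s B -> hmx (shift_cat sA sB) s (col_mx A B).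
Proof.
move=> hA hB i j; rewrite -(splitK i).
by case: (split i) => i0 /=; rewrite ?shift_catl ?shift_catr ?col_mxEu ?col_mxEd.
Qed.

Lemma hmx_col_const a b c n s (A : 'M[S]_(a, c)) (B : 'M[S]_(b, c)) :
  hmx (fun=> n) s A -> hmx (fun=> n) s B -> hmx (fun=> n) s (col_mx A B).
Proof. by move=> hA hB i j; rewrite mxE; case: split. Qed.

Lemma hmx_row_mx a b c s sA sB (A : 'M[S]_(c, a)) (B : 'M[S]_(c, b)) :
  hmx s sA A -> hmx s sB B -> hmx s (shift_cat sA sB) (row_mx A B).
Proof.
move=> hA hB i j; rewrite -(splitK j).
by case: (split j) => j0 /=; rewrite ?shift_catl ?shift_catr ?row_mxEl ?row_mxEr.
Qed.

Lemma ex_shift_cat a b sA sB j :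
  (exists i, @shift_cat a b sA sB i = j) <->
  (exists i, sA i = j) \/ (exists i, sB i = j).
Proof.
split=> [[i] | [[i <-] | [i <-]]].
- by rewrite /shift_cat; case: split => i0 <-; [left | right]; exists i0.
- by exists (lshift b i); rewrite shift_catl.
- by exists (rshift a i); rewrite shift_catr.
Qed.

Lemma scalemx_eq0 a b (f : S) (A : 'M[S]_(a, b)) : f != 0 -> f *: A = 0 -> A = 0.
Proof.
move=> f0 /matrixP h; apply/matrixP => i j; have := h i j.
by rewrite !mxE => /eqP; rewrite mulf_eq0 (negbTE f0) => /eqP.
Qed.

(* The connecting maps are divisible by [f], which keeps the
   resolution minimal when [f] has no constant term. *)
Lemma horseshoe (mn : bool) l a b e (f : S) (sA : 'I_a -> nat) (sB : 'I_b -> nat)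
    (Z : 'rV[S]_(a + b) -> Prop) (ZA : 'rV[S]_a -> Prop) (ZB : 'rV[S]_b -> Prop)
    (betaA betaB : nat -> nat -> Prop) :
    f != 0 -> (mn -> f@_0%MM = 0) -> (forall d, hdeg d (e + d) f) ->
    (forall v w c, Z v -> Z w -> Z (v - c *m w)) ->
    (forall w u, Z (row_mx w u) -> ZA w) ->
    (forall u, Z (row_mx 0 u) <-> ZB u) ->
    (forall u, ZB (f *: u) -> ZB u) ->
    (forall w d, hrow sA (e + d) w -> ZA w ->
       exists2 t, hrow sB d t & Z (row_mx w (f *: t))) ->
    (forall i j, betaA i j -> (e <= j)%N) ->
  resolution mn l sA ZA betaA -> resolution mn l sB ZB betaB ->
  resolution mn l (shift_cat sA sB) Z (fun i j => betaA i j \/ betaB i j).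
Proof.
move=> f0 mf hf.
elim: l a b sA sB Z ZA ZB betaA betaB
  => [|l IH] a b sA sB Z ZA ZB betaA betaB Zsub ZZA ZZB fZB lift bge.
  case=> hA bA [hB bB]; split=> [v|i j [/bA|/bB] //].
  rewrite -[v]hsubmxK; split=> [Zv|->].
    have /hA vl := ZZA _ _ Zv.
    by move: Zv; rewrite vl ZZB hB => ->; rewrite row_mx0.
  by rewrite -(row_mx0 _ 1 a b) ZZB hB.
case=> a' [sA' [DA [hDA mDA ZDA bDA rDA]]].
case=> b' [sB' [DB [hDB mDB ZDB bDB rDB]]].
(* The generators of [ZA] are lifted to [Z] with a second component divisible by [f]. *)
have /fin_all_exists [T TP] : forall i, exists t : 'rV[S]_b,
    hrow sB (sA' i - e) t /\ Z (row_mx (row i DA) (f *: t)).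
  have ge i : (e <= sA' i)%N by apply: (bge 0%N); apply/bDA; exists i.
  move=> i; have [||t ht Zt] := lift (row i DA) (sA' i - e)%N.
  - by rewrite subnKC //; apply: hmx_row.
  - by apply/ZDA; exists (delta_mx 0 i); rewrite rowE.
  by exists t.
pose Th := \matrix_i T i : 'M[S]_(a', b).
have hTh i j : hdeg (e + sB j) (sA' i) (Th i j).
  have ge : (e <= sA' i)%N by apply: (bge 0%N); apply/bDA; exists i.
  rewrite mxE -(subnKC ge); apply: hdeg_addl; by case: (TP i).
pose D := col_mx (row_mx DA (f *: Th)) (row_mx 0 DB) : 'M[S]_(a' + b', a + b).
have Zadd v w : Z v -> Z w -> Z (v + w).
  move=> Zv Zw; have := Zsub v w (- 1%:M) Zv Zw.
  by rewrite mulNmx mul1mx opprK.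
have Z0 : Z 0.
  by rewrite -(row_mx0 _ 1 a b) ZZB ZDB; exists 0; rewrite mul0mx.
have Zscale c v : Z v -> Z (c *m v).
  by move=> Zv; have := Zsub 0 v (- c) Z0 Zv; rewrite mulNmx sub0r opprK.
have Ztop (w : 'rV[S]_a') : Z (w *m row_mx DA (f *: Th)).
  rewrite mulmx_sum_row; elim/big_rec: _ => // i v _ Zv; apply: Zadd => //.
  rewrite -mul_scalar_mx; apply: Zscale.
  rewrite row_row_mx [row i (f *: _)](_ : _ = f *: T i); last first.
    by apply/rowP => j; rewrite !mxE.
  by case: (TP i).
exists (a' + b')%N, (shift_cat sA' sB'), D; split.
- apply: hmx_col; apply: hmx_row_mx => // i j; last by rewrite mxE; apply: hdeg0.
  by rewrite mxE mulrC; apply: hdegM (hTh i j) (hf _).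
- move=> mnT i j; rewrite -(splitK i) -(splitK j).
  case: (split i) => i0 /=; case: (split j) => j0 /=; rewrite /D.
  + by rewrite col_mxEu row_mxEl mDA.
  + by rewrite col_mxEu row_mxEr mxE rmorphM /= mf // mul0r.
  + by rewrite col_mxEd row_mxEl mxE mcoeff0.
  + by rewrite col_mxEd row_mxEr mDB.
- move=> v; split=> [Zv|[w ->]].
    have /ZDA [w Ew] : ZA (lsubmx v) by apply: ZZA (rsubmx v) _; rewrite hsubmxK.
    have : Z (v - 1%:M *m (w *m row_mx DA (f *: Th))) by apply: Zsub.
    rewrite mul1mx mul_mx_row -{1}[v]hsubmxK -Ew opp_row_mx add_row_mx subrr ZZB ZDB.
    case=> u Eu; exists (row_mx w u).
    rewrite mul_row_col !mul_mx_row mulmx0 add_row_mx addr0 -Ew -Eu.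
    by rewrite addrC subrK hsubmxK.
  rewrite -[w]hsubmxK mul_row_col; apply: Zadd => //.
  by rewrite mul_mx_row mulmx0 ZZB ZDB; exists (rsubmx w).
- by move=> j; rewrite bDA bDB ex_shift_cat.
have DE w u : row_mx w u *m D = row_mx (w *m DA) (f *: (w *m Th) + u *m DB).
  by rewrite mul_row_col !mul_mx_row mulmx0 add_row_mx addr0 -scalemxAr.
apply: (IH _ _ _ _ _ _ _ _ _ _ _ _ _ _ _ rDA rDB).
- by move=> v w c vD wD; rewrite mulmxBl -mulmxA vD wD mulmx0 subr0.
- by move=> w u; rewrite DE -(row_mx0 _ 1 a b) => /eq_row_mx [].
- move=> u; rewrite DE !mul0mx scaler0 add0r -(row_mx0 _ 1 a b).
  by split=> [/eq_row_mx [] // | ->].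
- by move=> u; rewrite -scalemxAl => /(scalemx_eq0 f0).
(* A relation [w] between the generators of [ZA] puts [f] times [w *m Th] into [ZB], where [f] can
   be cancelled. Cancelling before lifting along [DB] keeps the factor [f] in the next connecting
   map. *)
- move=> w d hw wDA.
  have /ZZB /fZB /ZDB wTh : Z (row_mx 0 (f *: (w *m Th))).
    by have := Ztop w; rewrite mul_mx_row wDA -scalemxAr.
  have hwTh : hrow sB d (w *m Th).
    move=> j m hm; apply: (@addnI e); rewrite addnCA; move: m hm; rewrite mxE.
    apply: hdeg_sum => i _; exact: hdegM (hw i) (hTh i j).
  have [u hu Eu] := hrow_lift hDB hwTh wTh.
  exists (- u); first by move=> j; rewrite mxE; apply: hdegN.
  by rewrite DE wDA Eu scalerN mulNmx -scalemxAl subrr row_mx0.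
- by move=> i j /bge.
Qed.

(** As [f] cancels modulo the image of [D], the first components of the kernel are the rows [w] with
    [w *m h] in that image; over [w = 0] the second components form the kernel of [D]. [horseshoe]
    applies to this extension. *)
Lemma resolution_ker_col (mn : bool) l a b c e (f : S) (sa : 'I_a -> nat) (sB : 'I_b -> nat)
    (s : 'I_c -> nat) (h : 'M[S]_(a, c)) (D : 'M[S]_(b, c))
    (betaA betaB : nat -> nat -> Prop) :
    f != 0 -> (mn -> f@_0%MM = 0) -> (forall d, hdeg d (e + d) f) ->
    hmx sa s h -> hmx sB s D ->
    (forall w : 'rV[S]_a, (exists u, f *: (w *m h) = u *m D) ->
       exists u, w *m h = u *m D) ->
    (forall i j, betaA i j -> (e <= j)%N) ->
  resolution mn l (fun i => e + sa i)%N (fun w => exists u, w *m h = u *m D) betaA ->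
  resolution mn l sB (fun w => w *m D = 0) betaB ->
  resolution mn l (shift_cat (fun i => e + sa i)%N sB)
    (fun w => w *m col_mx (f *: h) D = 0) (fun i j => betaA i j \/ betaB i j).
Proof.
move=> f0 mf hf hh hD reg bge rA rB.
have E w u : row_mx w u *m col_mx (f *: h) D = f *: (w *m h) + u *m D.
  by rewrite mul_row_col -scalemxAr.
apply: (horseshoe f0 mf hf _ _ _ _ _ bge rA rB).
- by move=> v w x vD wD; rewrite mulmxBl -mulmxA vD wD mulmx0 subr0.
- move=> w u; rewrite E => Ewu; apply: reg; exists (- u).
  by rewrite mulNmx; apply/eqP; rewrite -addr_eq0 Ewu.
- by move=> u; rewrite E mul0mx scaler0 add0r.
- by move=> u; rewrite -scalemxAl => /(scalemx_eq0 f0).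
- move=> w d hw Ew.
  have hwh : hrow s d (w *m h).
    apply: (hrow_mul hh) => i m /hw; rewrite addnCA; exact: addnI.
  have [u hu Eu] := hrow_lift hD hwh Ew.
  exists (- u); first by move=> j; rewrite mxE; apply: hdegN.
  by rewrite E Eu scalerN mulNmx -scalemxAl subrr.
Qed.

End Resolutions.

(** * Ideals of polynomials and setting a variable to zero *)

Section Ideals.
Variables (k : fieldType) (N : nat).
Local Notation S := {mpoly k[N]}.
Implicit Types (I : S -> Prop) (B : S -> Prop).

Definition is_ideal I : Prop :=
  [/\ I 0, forall p q, I p -> I q -> I (p + q) & forall c p, I p -> I (c * p)].

Lemma ideal_sum I (T : Type) (r : seq T) (P : pred T) (F : T -> S) :
  is_ideal I -> (forall i, P i -> I (F i)) -> I (\sum_(i <- r | P i) F i).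
Proof. by case=> I0 ID _ IF; elim/big_rec: _ => // i p Pi; apply: ID; apply: IF. Qed.

Lemma idealN I p : is_ideal I -> I p -> I (- p).
Proof. by case=> _ _ IM Ip; rewrite -mulN1r; apply: IM. Qed.

Lemma idealB I p q : is_ideal I -> I p -> I q -> I (p - q).
Proof. by move=> II Ip Iq; case: (II) => _ ID _; apply: ID => //; apply: idealN. Qed.

Lemma span_ideal B : is_ideal (ideal_span B).
Proof.
split.
- by exists 0%N, (fun=> 0), (fun=> 0); split; [case | rewrite big_ord0].
- move=> _ _ [r [c [g [Bg ->]]]] [r' [c' [g' [Bg' ->]]]].
  exists (r + r')%N, (fun i => match split i with inl i => c i | inr i => c' i end),
    (fun i => match split i with inl i => g i | inr i => g' i end).
  split; first by move=> i; case: split.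
  rewrite big_split_ord /=; congr (_ + _); apply: eq_bigr => i _.
    by rewrite (unsplitK (inl i)).
  by rewrite (unsplitK (inr i)).
- move=> a _ [r [c [g [Bg ->]]]]; exists r, (fun i => a * c i), g; split=> //.
  by rewrite mulr_sumr; apply: eq_bigr => i _; rewrite mulrA.
Qed.

Lemma span_gen B p : B p -> ideal_span B p.
Proof.
by exists 1%N, (fun=> 1), (fun=> p); split=> //; rewrite big_ord1 mul1r.
Qed.

Lemma span_min B I : is_ideal I -> (forall p, B p -> I p) ->
  forall p, ideal_span B p -> I p.
Proof.
move=> II BI _ [r [c [g [Bg ->]]]]; apply: (ideal_sum _ II) => i _.
by case: II => _ _ IM; apply/IM/BI.
Qed.

Lemma span_mono B B' : (forall p, B p -> B' p) ->
  forall p, ideal_span B p -> ideal_span B' p.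
Proof. by move=> BB'; apply: span_min (span_ideal B') _ => p /BB' /span_gen. Qed.

(* Unlike [span_min], [P] need not be stable under multiplication. *)
Lemma span_add_ind B (P : S -> Prop) : P 0 -> (forall p q, P p -> P q -> P (p + q)) ->
  (forall c p, B p -> P (c * p)) -> forall p, ideal_span B p -> P p.
Proof.
by move=> P0 PD PM _ [r [c [g [Bg ->]]]]; elim/big_rec: _ => // i p _; apply: PD; apply: PM.
Qed.

Lemma mvar_neq0 i : ('X_i : S) != 0.
Proof. by rewrite -msupp_eq0 msuppX. Qed.

Definition kill (i : 'I_N) : S -> S :=
  comp_mpoly [tuple if j == i then 0 else 'X_j | j < N].
HB.instance Definition _ i := GRing.RMorphism.on (kill i).

Lemma kill0 i : kill i 0 = 0. Proof. exact: rmorph0. Qed.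
Lemma killN i p : kill i (- p) = - kill i p. Proof. exact: rmorphN. Qed.
Lemma killD i p q : kill i (p + q) = kill i p + kill i q. Proof. exact: rmorphD. Qed.
Lemma killB i p q : kill i (p - q) = kill i p - kill i q. Proof. exact: rmorphB. Qed.
Lemma killM i p q : kill i (p * q) = kill i p * kill i q. Proof. exact: rmorphM. Qed.

Lemma killX i j : kill i 'X_j = if j == i then 0 else 'X_j.
Proof. by rewrite /kill comp_mpolyXU (nth_map j) ?size_enum_ord // nth_ord_enum. Qed.

Lemma kill_mnm i m : kill i 'X_[m] = if m i == 0%N then 'X_[m] else 0.
Proof.
case: eqP => [mi|/eqP mi].
  rewrite /kill comp_mpolyX [RHS]mpolyXE_id; apply: eq_bigr => j _.
  by rewrite tnth_mktuple; case: eqP => // ->; rewrite mi.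
have -> : m = (U_(i) + (m - U_(i)))%MM.
  by rewrite addmC submK // lep1mP.
by rewrite mpolyXD killM /= killX eqxx mul0r.
Qed.

Lemma kill_split i p : exists2 q, p = kill i p + 'X_i * q &
  forall n, (msize p <= n.+1)%N -> (msize q <= n)%N.
Proof.
exists (\sum_(m <- msupp p) if m i == 0%N then 0 else p@_m *: 'X_[m - U_(i)]).
  rewrite {1 2}[p]mpolyE [kill i _]raddf_sum mulr_sumr -big_split /=.
  apply: eq_bigr => m _; rewrite /kill comp_mpolyZ -/(kill i _) kill_mnm.
  case: eqP => [|/eqP mi]; first by rewrite mulr0 addr0.
  rewrite scaler0 add0r -scalerAr -mpolyXD addmC submK //.
  by rewrite lep1mP.
move=> n pn; rewrite big_seq_cond.
elim/big_rec: _ => [|m q /andP [mp _] hq]; first by rewrite mmeasure0.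
apply: leq_trans (msizeD_le _ _) _; rewrite geq_max hq andbT.
case: eqP => [|/eqP mi]; first by rewrite mmeasure0.
apply: leq_trans (msizeZ_le _ _) _; rewrite msizeX.
have := leq_trans (msize_mdeg_lt mp) pn; rewrite ltnS; apply: leq_trans.
have -> : mdeg m = (mdeg (m - U_(i)) + 1)%N; last by rewrite addn1.
by rewrite -(mdeg1 i) -mdegD submK // lep1mP.
Qed.

Lemma kill_span i B : (forall g, B g -> kill i g = g) ->
  forall p, ideal_span B p -> ideal_span B (kill i p).
Proof.
move=> fixB; have [I0 ID IM] := span_ideal B.
apply: span_add_ind => [|p q Ip Iq|c p Bp].
- by rewrite kill0.
- by rewrite killD; apply: ID.
- by rewrite killM /= (fixB _ Bp); apply/IM/span_gen.
Qed.

(** The variable does not occur in the generators, so each member of the ideal is its value at zero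
    plus ['X_i] times another member. For a multiple of ['X_i] the value at zero vanishes, and
    ['X_i] cancels. *)
Lemma span_varM i B : (forall g, B g -> kill i g = g) ->
  forall p, ideal_span B ('X_i * p) -> ideal_span B p.
Proof.
move=> fixB p; have [I0 ID IM] := span_ideal B.
suff H q : ideal_span B q -> exists2 r, ideal_span B r & q = kill i q + 'X_i * r.
  case/H => r Br; rewrite killM /= killX eqxx mul0r add0r.
  by move/(mulfI (mvar_neq0 _)) => ->.
move: q; apply: span_add_ind => [|p1 p2 [r1 B1 E1] [r2 B2 E2]|c g Bg].
- by exists 0; rewrite // kill0 mulr0 addr0.
- by exists (r1 + r2); rewrite ?killD ?mulrDr; [exact: ID | rewrite addrACA -E1 -E2].
- have [q Ec _] := kill_split i c; exists (q * g); first exact/IM/span_gen.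
  by rewrite killM /= (fixB _ Bg) mulrA -mulrDl -Ec.
Qed.

(* Here [a], [c], [b], [d] are the indices of [x_a], [y_a], [x_b], [y_b]. Setting
   [x_b] to 0 shows that the part of [p] free of [x_b] lies in the ideal, which
   lowers the degree in [x_b]. *)
Lemma span_minorM a c b d B : b != d -> b != a -> d != a ->
  (forall g, B g -> kill b g = g) -> (forall g, B g -> kill d g = g) ->
  (forall p, ideal_span B ('X_a * p) -> ideal_span B p) ->
  forall p, ideal_span B (('X_a * 'X_d - 'X_b * 'X_c) * p) -> ideal_span B p.
Proof.
move=> bd ba da fb fd ra p; have II := span_ideal B; have [I0 ID IM] := II.
have [n] := ubnP (msize p); elim: n p => [//|n IH] p; rewrite ltnS => pn Ip.
have Ik : ideal_span B (kill b p).
  have := kill_span fb Ip; rewrite killM killB !killM !killX eqxx.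
  rewrite [a == b]eq_sym (negbTE ba) [d == b]eq_sym (negbTE bd) mul0r subr0.
  by rewrite mulrAC mulrC => /(span_varM fd) /ra.
have [q Ep qn] := kill_split b p.
rewrite Ep; apply: (ID) => //; apply: (IM).
(* With [n = 0] the size bound forces [p = 0], hence [q = 0]. *)
case: n IH pn qn => [|n] IH pn qn.
  move: pn; rewrite leqn0 msize_poly_eq0 => /eqP p0.
  have : 'X_b * q = 0 by move: Ep; rewrite p0 kill0 add0r.
  by move/eqP; rewrite mulf_eq0 (negbTE (mvar_neq0 _)) => /eqP ->.
apply: IH; first by rewrite ltnS; apply: qn.
apply: (span_varM fb); rewrite mulrCA.
have -> : 'X_b * q = p - kill b p by rewrite {1}Ep addrC addKr.
by rewrite mulrBr; exact: (idealB II Ip (IM _ _ Ik)).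
Qed.
End Ideals.

(** * Free vertices and regular variables *)

Section EdgeIdeals.
Variables (k : fieldType) (V : finType).
Local Notation S := {mpoly k[#|V| + #|V|]}.
Local Notation xi v := (lshift #|V| (enum_rank v)).
Local Notation yi v := (rshift #|V| (enum_rank v)).
Local Notation x v := (xvar k v).
Local Notation y v := (yvar k v).
Implicit Types (e : rel V) (p q : S).

Definition edge_minor (u v : V) : S := x u * y v - x v * y u.

Definition edge_gen e : S -> Prop := fun p => exists u v, e u v /\ p = edge_minor u v.

(** Graphs are bare relations from here on, so that deletion, completion and union carry no axioms;
    symmetry and irreflexivity are assumed where they are used. *)
Definition edge_ideal e : S -> Prop := ideal_span (edge_gen e).

Lemma minor_kill_fixed i u v : kill i (x u) = x u -> kill i (y v) = y v ->
  kill i (x v) = x v -> kill i (y u) = y u -> kill i (edge_minor u v) = edge_minor u v.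
Proof. by move=> h1 h2 h3 h4; rewrite /edge_minor killB !killM h1 h2 h3 h4. Qed.

Lemma killx_x v u : kill (xi v) (x u) = if u == v then 0 else x u.
Proof. by rewrite /xvar killX (inj_eq (@lshift_inj _ _)) (inj_eq enum_rank_inj). Qed.

Lemma killx_y v u : kill (xi v) (y u) = y u.
Proof. by rewrite /yvar killX eq_rlshift. Qed.

Lemma killy_x v u : kill (yi v) (x u) = x u.
Proof. by rewrite /xvar killX eq_lrshift. Qed.

Lemma killy_y v u : kill (yi v) (y u) = if u == v then 0 else y u.
Proof. by rewrite /yvar killX (inj_eq (@rshift_inj _ _)) (inj_eq enum_rank_inj). Qed.

Lemma killx_minor v u w : u != v -> w != v -> kill (xi v) (edge_minor u w) = edge_minor u w.
Proof.
by move=> /negbTE uv /negbTE wv; apply: minor_kill_fixed; rewrite ?killx_x ?killx_y ?uv ?wv.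
Qed.

Lemma killy_minor v u w : u != v -> w != v -> kill (yi v) (edge_minor u w) = edge_minor u w.
Proof.
by move=> /negbTE uv /negbTE wv; apply: minor_kill_fixed; rewrite ?killy_x ?killy_y ?uv ?wv.
Qed.

Lemma minorC u v : edge_minor u v = - edge_minor v u.
Proof. by rewrite /edge_minor opprB. Qed.

Lemma minorxx u : edge_minor u u = 0.
Proof. by rewrite /edge_minor subrr. Qed.

Lemma edge_ideal_minor e u v : e u v -> edge_ideal e (edge_minor u v).
Proof. by move=> uv; apply: span_gen; exists u, v. Qed.

Lemma edge_ideal_sub e e' : subrel e e' ->
  forall p, edge_ideal e p -> edge_ideal e' p.
Proof. by move=> ee'; apply: span_mono => p [u [v [/ee' uv ->]]]; exists u, v. Qed.

Definition isolated e (v : V) : Prop := forall u, ~~ e u v /\ ~~ e v u.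

Lemma isolated_neq e v u w : isolated e v -> e u w -> u != v /\ w != v.
Proof.
by move=> iso euw; split; apply: contraTneq euw => ->; case: (iso u); case: (iso w).
Qed.

Lemma isolated_killx e v : isolated e v -> forall p, edge_gen e p -> kill (xi v) p = p.
Proof.
by move=> iso p [u [w [/(isolated_neq iso) [uv wv] ->]]]; apply: killx_minor.
Qed.

Lemma isolated_killy e v : isolated e v -> forall p, edge_gen e p -> kill (yi v) p = p.
Proof.
by move=> iso p [u [w [/(isolated_neq iso) [uv wv] ->]]]; apply: killy_minor.
Qed.

Definition xregular e (z : V) : Prop :=
  forall p, edge_ideal e (x z * p) -> edge_ideal e p.

Lemma minor_regular e a b : a != b -> isolated e b -> xregular e a ->
  forall p, edge_ideal e (edge_minor a b * p) -> edge_ideal e p.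
Proof.
move=> ab iso reg; apply: span_minorM reg.
- by rewrite eq_lrshift.
- by rewrite (inj_eq (@lshift_inj _ _)) (inj_eq enum_rank_inj) eq_sym.
- by rewrite eq_rlshift.
- exact: isolated_killx.
- exact: isolated_killy.
Qed.

(** For a graph this amounts to lying in exactly one maximal clique. *)
Definition is_free e (z : V) : Prop :=
  forall u w, e z u -> e z w -> u != w -> e u w.

(** * Deletion of a vertex and completion of its neighbourhood *)

Definition del e (v : V) : rel V := fun u w => [&& e u w, u != v & w != v].

(** For a graph [e], the edge ideal is the intersection of the ideal of this completed graph with
    the sum of the ideal of [del e v] and the ideal of [x v] and [y v]. The inclusion that matters
    is [edge_ideal_complete_at]. *)
Definition complete_at e (v : V) : rel V :=
  fun u w => e u w || [&& u != w, e v u & e v w].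

Lemma del_isolated e v : isolated (del e v) v.
Proof. by move=> u; rewrite /del eqxx !andbF. Qed.

Lemma edge_ideal_del e v p : edge_ideal (del e v) p -> edge_ideal e p.
Proof. by apply: edge_ideal_sub => u w /and3P []. Qed.

Definition killv (v : V) (p : S) := kill (yi v) (kill (xi v) p).

Lemma killv_del e v p : edge_ideal e p -> edge_ideal (del e v) (killv v p).
Proof.
have [I0 ID IM] := span_ideal (edge_gen (del e v)).
move: p; apply: span_add_ind => [|p q|c _ [u [w [euw ->]]]].
- by rewrite /killv !kill0.
- by rewrite /killv !killD; apply: ID.
rewrite /killv !killM.
case: (eqVneq u v) => [->|uv].
  rewrite /edge_minor !(killB, killM) !(killx_x, killx_y, killy_x, killy_y) eqxx.
  by rewrite kill0 mul0r mulr0 subrr mulr0.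
case: (eqVneq w v) => [->|wv].
  rewrite /edge_minor !(killB, killM) !(killx_x, killx_y, killy_x, killy_y) eqxx.
  by rewrite kill0 mul0r mulr0 subrr mulr0.
rewrite killx_minor // killy_minor //; apply/IM/edge_ideal_minor.
by rewrite /del euw uv.
Qed.

(* [x_v] and [y_v] multiply the new generators into the old ideal, so only their
   coefficients free of [x_v] and [y_v] matter. *)
Lemma edge_ideal_complete_at e v p : irreflexive e -> ssrbool.symmetric e ->
  edge_ideal (complete_at e v) p -> edge_ideal (del e v) (killv v p) ->
  edge_ideal e p.
Proof.
move=> irr sym Cp Dp; have II := span_ideal (edge_gen e); have [I0 ID IM] := II.
suff : edge_ideal e (p - killv v p).
  by move/ID => /(_ _ (edge_ideal_del Dp)); rewrite subrK.
move: p Cp {Dp}; apply: span_add_ind => [|p q Ip Iq|c _ [u [w [euw ->]]]].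
- by rewrite /killv !kill0 subr0.
- by rewrite /killv !killD opprD addrACA; exact: ID _ _ Ip Iq.
case/orP: euw => [euw | /and3P [uw evu evw]].
  apply: (idealB II); first exact/IM/edge_ideal_minor.
  by apply/edge_ideal_del/killv_del/IM/edge_ideal_minor.
have uv : u != v by apply: contraTneq evu => ->; rewrite irr.
have wv : w != v by apply: contraTneq evw => ->; rewrite irr.
rewrite /killv !killM killx_minor // killy_minor // -mulrBl.
have [q Ec _] := kill_split (xi v) c.
have [q' Ec' _] := kill_split (yi v) (kill (xi v) c).
have -> : c - kill (yi v) (kill (xi v) c) = y v * q' + x v * q.
  by rewrite {1}Ec {1}Ec' addrC -addrA addKr.
have -> : (y v * q' + x v * q) * edge_minor u w =
    (q' * y u + q * x u) * edge_minor v w - (q' * y w + q * x w) * edge_minor v u.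
  by rewrite /edge_minor; ring.
by apply: (idealB II); apply/IM/edge_ideal_minor.
Qed.

Definition xlin e z (d : V -> S) : S := \sum_(j | e z j) d j * x j.
Definition ylin e z (d : V -> S) : S := \sum_(j | e z j) d j * y j.

Lemma xlin_single e z v s : e z v -> xlin e z (fun j => if j == v then s else 0) = s * x v.
Proof.
move=> ezv; rewrite /xlin (bigD1 v) //= eqxx big1 ?addr0 // => j /andP [_ /negbTE ->].
by rewrite mul0r.
Qed.

Lemma ylin_single e z v s : e z v -> ylin e z (fun j => if j == v then s else 0) = s * y v.
Proof.
move=> ezv; rewrite /ylin (bigD1 v) //= eqxx big1 ?addr0 // => j /andP [_ /negbTE ->].
by rewrite mul0r.
Qed.

(* Multiplying by [x_i], for a common neighbour [i], turns a relation between the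
   [x_j] modulo the ideal into the same relation between the [y_j]. *)
Lemma edge_ideal_xy (I : finType) (P : pred I) (d : I -> S) (v : I -> V) e i :
  (forall j, P j -> v j != i -> e i (v j)) -> xregular e i ->
  edge_ideal e (\sum_(j | P j) d j * x (v j)) ->
  edge_ideal e (\sum_(j | P j) d j * y (v j)).
Proof.
move=> ei reg hx; apply: reg.
have II := span_ideal (edge_gen e); have [I0 ID IM] := II.
have -> : x i * (\sum_(j | P j) d j * y (v j)) =
    y i * (\sum_(j | P j) d j * x (v j)) + \sum_(j | P j) d j * edge_minor i (v j).
  rewrite !mulr_sumr -big_split /=; apply: eq_bigr => j _.
  by rewrite /edge_minor; ring.
apply: ID; first exact: IM.
apply: (ideal_sum _ II) => j Pj; apply: IM; case: (eqVneq (v j) i) => [->|ji].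
  by rewrite minorxx.
by apply/edge_ideal_minor/ei.
Qed.

(** Write [x z * p] with [x z] explicit. Setting [x z] to zero and cancelling [y z] puts the form
    [xlin] into the ideal of the graph without [z]. Through a neighbour of [z], [edge_ideal_xy] does
    the same for [ylin], and [p] differs from [ylin] by a member of the ideal. *)
Lemma xregular_cluster e z : irreflexive e -> ssrbool.symmetric e -> is_free e z ->
  (forall i, e z i -> xregular (del e z) i) -> xregular e z.
Proof.
move=> irr sym fz reg p Ip.
have II := span_ideal (edge_gen e); have [I0 ID IM] := II.
have II' := span_ideal (edge_gen (del e z)); have [I0' ID' IM'] := II'.
have : exists j1 j0 d, [/\ edge_ideal e j1, edge_ideal (del e z) j0,
    kill (xi z) j0 = j0, kill (xi z) (xlin e z d) = xlin e z d &
    x z * p = x z * j1 + j0 + (x z * ylin e z d - y z * xlin e z d)].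
  move: Ip; set q := x z * p; move: q.
  apply: span_add_ind => [|q1 q2|c _ [u [w [euw ->]]]].
  - exists 0, 0, (fun=> 0); split=> //; rewrite /xlin /ylin ?kill0 //.
      by rewrite big1 ?kill0 // => i _; rewrite mul0r.
    by rewrite !big1 ?mulr0 ?subrr ?addr0 // => i _; rewrite mul0r.
  - move=> [i1 [i0 [d [Ii1 Ii0 k0 kd ->]]]] [j1 [j0 [d' [Ij1 Ij0 k0' kd' ->]]]].
    have Ex : xlin e z (fun j => d j + d' j) = xlin e z d + xlin e z d'.
      by rewrite -big_split; apply: eq_bigr => j _; rewrite mulrDl.
    have Ey : ylin e z (fun j => d j + d' j) = ylin e z d + ylin e z d'.
      by rewrite -big_split; apply: eq_bigr => j _; rewrite mulrDl.
    exists (i1 + j1), (i0 + j0), (fun j => d j + d' j); split.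
    + exact: ID.
    + exact: ID'.
    + by rewrite killD /= k0 k0'.
    + by rewrite Ex killD /= kd kd'.
    + by rewrite Ex Ey; ring.
  (* The multiple of [x z] in the coefficient goes into [j1]. The rest, free of [x z], goes into [d]
     if the edge meets [z], and into [j0] otherwise. *)
  have [q Ec _] := kill_split (xi z) c; set c0 := kill _ c in Ec.
  have kc0 : kill (xi z) c0 = c0.
    have := congr1 (kill (xi z)) Ec; rewrite killD killM /= killX eqxx mul0r addr0.
    by rewrite -/c0.
  have lin0 : xlin e z (fun=> 0) = 0 /\ ylin e z (fun=> 0) = 0.
    by rewrite /xlin /ylin !big1 // => j _; rewrite mul0r.
  have Iq : edge_ideal e (q * edge_minor u w) by apply/IM/edge_ideal_minor.
  case: (eqVneq u z) => [uz|uz].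
    rewrite uz in euw Iq *.
    have wz : w != z by apply: contraTneq euw => ->; rewrite irr.
    have Ex := xlin_single c0 euw; have Ey := ylin_single c0 euw.
    exists (q * edge_minor z w), 0, (fun j => if j == w then c0 else 0); split=> //.
    + by rewrite kill0.
    + by rewrite Ex killM /= kc0 killx_x (negbTE wz).
    + by rewrite Ex Ey {1}Ec /edge_minor /xvar; ring.
  case: (eqVneq w z) => [wz|wz].
    rewrite wz in euw Iq *; rewrite sym in euw.
    have Ex := xlin_single (- c0) euw; have Ey := ylin_single (- c0) euw.
    exists (q * edge_minor u z), 0, (fun j => if j == u then - c0 else 0); split=> //.
    + by rewrite kill0.
    + by rewrite Ex killM killN /= kc0 killx_x (negbTE uz).
    + by rewrite Ex Ey {1}Ec /edge_minor /xvar; ring.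
  have [Ex Ey] := lin0.
  exists (q * edge_minor u w), (c0 * edge_minor u w), (fun=> 0); split=> //.
  + by apply/IM'/edge_ideal_minor; rewrite /del euw uz.
  + by rewrite killM /= kc0 killx_minor.
  + by rewrite Ex kill0.
  + by rewrite Ex Ey {1}Ec /xvar; ring.
case=> j1 [j0 [d [Ij1 Ij0 k0 kd E]]].
have Ej0 : j0 = y z * xlin e z d.
  move/(congr1 (kill (xi z))): E.
  rewrite !(killB, killD, killM) killx_x killx_y eqxx k0 kd.
  by rewrite !mul0r add0r sub0r => /esym /eqP; rewrite subr_eq0 => /eqP.
have Ep : p = j1 + ylin e z d.
  by apply: (mulfI (mvar_neq0 k (xi z))); rewrite -/(x z) E Ej0; ring.
have Ix : edge_ideal (del e z) (xlin e z d).
  apply: (span_varM (isolated_killy (@del_isolated e z))).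
  by rewrite -/(y z) -Ej0.
rewrite Ep; apply: ID => //.
case: (pickP (e z)) => [i ezi|none].
  apply: edge_ideal_del; apply: (edge_ideal_xy _ (reg _ ezi) Ix) => j ezj ji.
  rewrite /del (fz _ _ ezi ezj) 1?eq_sym //=.
  by apply/andP; split; [apply: contraTneq ezi | apply: contraTneq ezj] => ->;
    rewrite irr.
by rewrite /ylin big1 // => j; rewrite none.
Qed.

(* Completing the neighbourhood of a vertex that is not free, or deleting it,
   reduces to a disjoint union of cliques. *)
Theorem free_xregular e z : irreflexive e -> ssrbool.symmetric e -> is_free e z ->
  xregular e z.
Proof.
(* Lexicographic induction, where [W] contains every vertex that has an edge. Deleting a vertex
   shrinks [W]; completing at a vertex that is not free keeps [W] and removes a non-adjacent
   pair. *)
pose nonedges (W : {set V}) e := #|[set c : V * V | [&& c.1 \in W, c.2 \in W & ~~ e c.1 c.2]]|.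
suff H n m (W : {set V}) : (#|W| < n)%N -> (nonedges W e < m)%N ->
    (forall u w, e u w -> u \in W) ->
    irreflexive e -> ssrbool.symmetric e -> is_free e z -> xregular e z.
  by apply: (H _ _ setT (ltnSn _) (ltnSn _)) => u w _; rewrite inE.
elim: n m W e z => [//|n IHn]; elim=> [//|m IHm] W e z Wn em eW irr sym fz.
have delW v u : e v u -> (#|W :\ v| < n)%N.
  by move/eW => vW; move: Wn; rewrite (cardsD1 v W) vW.
have IHdel v u z' : e v u -> is_free e z' -> xregular (del e v) z'.
  move=> evu fz'; apply: (IHn _ (W :\ v) _ _ (delW _ _ evu) (ltnSn _)).
  - by move=> a b /and3P [/eW aW av _]; rewrite !inE av.
  - by move=> a; rewrite /del irr.
  - by move=> a b; rewrite /del sym [(a != v) && _]andbC.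
  - move=> a b /and3P [za z'v av] /and3P [zb _ bv] ab.
    by rewrite /del (fz' _ _ za zb ab) av.
case: (pickP [pred c : V * (V * V) |
    [&& e c.1 c.2.1, e c.1 c.2.2, c.2.1 != c.2.2 & ~~ e c.2.1 c.2.2]]).
  case=> v [u w] /and4P [/= evu evw uw neuw].
  have zv : z != v by apply: contraNneq neuw => zv; apply: fz; rewrite ?zv.
  move=> p Ip; apply: (@edge_ideal_complete_at e v) => //; last first.
    apply: (IHdel v u z evu fz).
    have := @killv_del e v _ Ip; rewrite /killv !killM.
    by rewrite killx_x (negbTE zv) killy_x.
  have : edge_ideal (complete_at e v) (x z * p).
    by apply: edge_ideal_sub Ip => a b ab; rewrite /complete_at ab.
  apply: (IHm W).
  - exact: Wn.
  - rewrite -ltnS; apply: leq_trans em; rewrite ltnS; apply: proper_card.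
    apply/properP; split.
      apply/subsetP => -[a b]; rewrite !inE /= => /and3P [-> -> /=].
      by rewrite /complete_at negb_or => /andP [].
    exists (u, w); rewrite !inE /= ?negb_and /complete_at.
      by rewrite (eW u v) ?(eW w v) // 1?sym.
    by rewrite uw evu evw orbT /= !orbT.
  - by move=> a b /orP [/eW // | /and3P [_ eva _]]; apply: (eW a v); rewrite sym.
  - by move=> a; rewrite /complete_at irr eqxx.
  - by move=> a b; rewrite /complete_at sym eq_sym [e v a && _]andbC.
  (* [z] stays free: it gains neighbours only if it is adjacent to [v], and then, as [z] was free,
     each old neighbour is [v] or a neighbour of [v]. The neighbours of [v] have become pairwise
     adjacent. *)
  - have N a : complete_at e v z a -> e z a || [&& e v z, e v a & z != a].
      by case/orP => [-> // | /and3P [-> -> ->]]; rewrite orbT.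
    move=> a b /N Na /N Nb ab; rewrite /complete_at ab /=.
    have star c : e v z -> e z c -> (c == v) || e v c.
      by move=> vz zc; case: eqVneq => //= cv; apply: (fz v c); rewrite // 1?sym // eq_sym.
    case/orP: Na => [za|/and3P [vz va _]]; case/orP: Nb => [zb|/and3P [vz' vb _]].
    + by rewrite fz.
    + case/orP: (star a vz' za) => [/eqP ->|va]; first by rewrite vb.
      by rewrite va vb orbT.
    + case/orP: (star b vz zb) => [/eqP ->|vb]; first by rewrite sym va.
      by rewrite va vb orbT.
    + by rewrite va vb orbT.
(* Every vertex is free now, in particular each neighbour of [z], so the induction hypothesis
   applies to it once [z] is deleted. *)
move=> allfree; apply: xregular_cluster => // i ezi; apply: (IHdel z i) => //.
move=> u w eiu eiw uw; have := allfree (i, (u, w)).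
by rewrite /= eiu eiw uw /= => /negbFE.
Qed.

End EdgeIdeals.

(** * Linear resolutions *)

Section Images.
Variables (k : fieldType) (N : nat).
Local Notation S := {mpoly k[N]}.

Lemma resolution_im (mn : bool) l a b (s : 'I_b -> nat) (s' : 'I_a -> nat)
    (D : 'M[S]_(a, b)) beta :
  hmx s' s D -> (mn -> forall i j, (D i j)@_0%MM = 0) ->
  resolution mn l s' (fun w => w *m D = 0) beta ->
  resolution mn l.+1 s (fun v => exists w, v = w *m D)
    (fun i j => if i is i'.+1 then beta i' j else exists i, s' i = j).
Proof. by move=> hD mD rD; exists a, s', D. Qed.

Lemma col_span a (D : 'M[S]_(a, 1)) (v : 'rV[S]_1) :
  (exists w, v = w *m D) <->
  ideal_span (fun p => exists i, p = D i ord0) (v ord0 ord0).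
Proof.
split=> [[w ->] | ].
  rewrite mxE; apply: (ideal_sum _ (span_ideal _)) => i _.
  have [_ _ IM] := span_ideal (fun p => exists i, p = D i ord0).
  by apply/IM/span_gen; exists i.
have I : is_ideal (fun p => exists w : 'rV_a, p = (w *m D) ord0 ord0).
  split.
  - by exists 0; rewrite mul0mx mxE.
  - by move=> _ _ [w ->] [w' ->]; exists (w + w'); rewrite mulmxDl [RHS]mxE.
  - by move=> c _ [w ->]; exists (c *: w); rewrite -scalemxAl [RHS]mxE.
case/(span_min I) => [_ [i ->]|w Ew].
  by exists (delta_mx 0 i); rewrite -rowE mxE.
by exists w; apply/rowP => i; rewrite ord1.
Qed.

Definition linear_from (c : nat) (beta : nat -> nat -> Prop) : Prop :=
  forall i j, beta i j -> j = (i + c)%N.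

(** [c] is the degree of the basis around [Z], so [Z] itself is generated in degree [c.+1].
    Minimality is recovered from the degrees by [resolution_linear_minimal]. *)
Definition has_linear_resolution c b (Z : 'rV[S]_b -> Prop) : Prop :=
  exists l beta, linear_from c.+1 beta /\ resolution false l (fun=> c) Z beta.

Lemma linear_resolution_ext c b (Z Z' : 'rV[S]_b -> Prop) :
  (forall v, Z v <-> Z' v) -> has_linear_resolution c Z -> has_linear_resolution c Z'.
Proof.
move=> ZZ' [l [beta [lb r]]]; exists l, beta; split=> //.
exact: resolution_ext r.
Qed.

Lemma linear_resolution0 c (Z : 'rV[S]_0 -> Prop) : Z 0 -> has_linear_resolution c Z.
Proof.
move=> Z0; exists 0%N, (fun _ _ => False); split=> //; split=> [v|i j []].
have -> : v = 0 by apply/rowP; case.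
by split.
Qed.

Lemma linear_resolutionS c b (Z : 'rV[S]_b -> Prop) :
  has_linear_resolution c Z -> has_linear_resolution c.+1 Z.
Proof.
move=> [l [beta [lb r]]]; exists l, (fun i j => exists2 j', beta i j' & j = (1 + j')%N).
split; last by apply: resolution_ext (resolution_shift 1 r).
by move=> i _ [j /lb -> ->]; rewrite addnCA.
Qed.

Lemma linear_resolution_im c a b (D : 'M[S]_(a, b)) :
  hmx (fun=> c.+1) (fun=> c) D ->
  has_linear_resolution c.+1 (fun w => w *m D = 0) ->
  has_linear_resolution c (fun v => exists w, v = w *m D).
Proof.
move=> hD [l [beta [lb r]]]; exists l.+1; eexists; split; last exact: resolution_im r.
by move=> [|i] j; [case=> _ <- | move/lb ->; rewrite addnS].
Qed.

Lemma linear_resolution_first c b (Z : 'rV[S]_b -> Prop) :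
  has_linear_resolution c Z -> exists a (D : 'M[S]_(a, b)),
  [/\ hmx (fun=> c.+1) (fun=> c) D, forall v, Z v <-> exists w, v = w *m D
    & has_linear_resolution c.+1 (fun w => w *m D = 0)].
Proof.
case=> l [beta [lb /resolutionS [a [s' [D [hD _ ZD bD rD]]]]]].
have Es i : s' i = c.+1 by apply: (lb 0%N); apply/bD; exists i.
exists a, D; split=> //.
  by move=> i j; rewrite -(Es i).
exists l, (fun i => beta i.+1); split; first by move=> i j /lb ->; rewrite addSnnS.
exact: resolution_ext rD.
Qed.

(** The case [f = 1], [e = 0] of [resolution_ker_col]: an extension of two linear pieces of the same
    degree is linear. *)
Lemma linear_resolution_ker_col c d a b n (h : 'M[S]_(a, n)) (D : 'M[S]_(b, n)) :
  hmx (fun=> c) (fun=> d) h -> hmx (fun=> c) (fun=> d) D ->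
  has_linear_resolution c (fun w => exists u, w *m h = u *m D) ->
  has_linear_resolution c (fun w => w *m D = 0) ->
  has_linear_resolution c (fun w => w *m col_mx h D = 0).
Proof.
move=> hh hD [l1 [bA [lA rA]]] [l2 [bB [lB rB]]].
exists (maxn l1 l2), (fun i j => bA i j \/ bB i j).
split; first by move=> i j [/lA | /lB].
have {}rA := resolution_leq (leq_maxl l1 l2) rA.
have {}rB := resolution_leq (leq_maxr l1 l2) rB.
have := resolution_ker_col (mn := false) (e := 0) (f := 1) (oner_neq0 _) _ _ hh hD _ _ rA rB.
rewrite scale1r => H; apply: resolution_ext (H _ _ _ _) => //.
- by move=> i; rewrite /shift_cat; case: split.
- by move=> e; rewrite -mpolyC1; apply: hdegC.
- by move=> w; rewrite scale1r.
Qed.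
End Images.

(** * The ideal of a complete graph *)

Section CompleteGraph.
Variables (k : fieldType) (V : finType).
Local Notation S := {mpoly k[#|V| + #|V|]}.
Local Notation xi v := (lshift #|V| (enum_rank v)).
Local Notation yi v := (rshift #|V| (enum_rank v)).
Local Notation x v := (xvar k v).
Local Notation y v := (yvar k v).
Local Notation minor := (edge_minor k).

Lemma hdeg_xvar d (v : V) : hdeg d d.+1 (x v).
Proof. by have := @hdegX k _ d U_(xi v)%MM; rewrite mdeg1. Qed.

Lemma hdeg_yvar d (v : V) : hdeg d d.+1 (y v).
Proof. by have := @hdegX k _ d U_(yi v)%MM; rewrite mdeg1. Qed.

Lemma hdeg_minor d (u v : V) : hdeg d d.+2 (minor u v).
Proof.
rewrite /edge_minor; apply: hdegD; last apply: hdegN.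
  by apply: hdegM (@hdeg_xvar d.+1 _) (@hdeg_yvar d _).
by apply: hdegM (@hdeg_xvar d.+1 _) (@hdeg_yvar d _).
Qed.

Definition xcol r (q : 'I_r -> V) : 'M[S]_(r, 1) := \matrix_(i, j) x (q i).

Lemma xcol_hmx r (q : 'I_r -> V) d : hmx (fun=> d.+1) (fun=> d) (xcol q).
Proof. by move=> i j; rewrite mxE; apply: hdeg_xvar. Qed.

Lemma xcol_rec r (q : 'I_r.+1 -> V) :
  xcol q = col_mx (x (q ord0))%:M (xcol (fun i => q (lift ord0 i))) :> 'M[S]_(1 + r, 1).
Proof.
apply/matrixP => i j; rewrite [RHS]mxE mxE; case: split_ordP => i0 ->; rewrite mxE.
  by rewrite !ord1; congr (x (q _)); apply: val_inj.
by congr (x (q _)); apply: val_inj.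
Qed.

(** The variable adjoined is regular modulo the others, so its coefficients in the relations form
    the ideal of the others, which is linear by induction. *)
Lemma koszul_linear r (q : 'I_r -> V) : injective q ->
  has_linear_resolution 1 (fun w => w *m xcol q = 0).
Proof.
elim: r q => [|r IH] q inj_q.
  by apply: linear_resolution0; rewrite mul0mx.
set q' := fun i => q (lift ord0 i).
have inj_q' : injective q' by move=> i j /inj_q /lift_inj.
rewrite xcol_rec -/q'; apply: (@linear_resolution_ker_col _ _ 1 0 1 r 1 (x (q ord0))%:M (xcol q')).
- move=> i j; rewrite !mxE !ord1 eqxx mulr1n; exact: hdeg_xvar.
- exact: xcol_hmx.
- have r2 := linear_resolutionS (IH _ inj_q').
  have r1 := linear_resolution_im (@xcol_hmx _ q' 1) r2.
  apply: (linear_resolution_ext _ r1) => v; split=> [[w ->]|].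
    by exists (x (q ord0) *: w); rewrite mul_mx_scalar scalemxAl.
  case=> u Eu; apply/col_span.
  have /col_span : exists u, v *m (x (q ord0))%:M = u *m xcol q' by exists u.
  rewrite mul_mx_scalar mxE; apply: span_varM => _ [i ->]; rewrite mxE killx_x.
  by rewrite (inj_eq inj_q) eq_sym (negbTE (neq_lift _ _)).
- exact: IH.
Qed.

Definition complete_rel (W : {set V}) : rel V := fun u w => [&& u != w, u \in W & w \in W].

Lemma complete_rel_irr W : irreflexive (complete_rel W).
Proof. by move=> u; rewrite /complete_rel eqxx. Qed.

Lemma complete_rel_sym W : ssrbool.symmetric (complete_rel W).
Proof. by move=> u w; rewrite /complete_rel eq_sym [(u \in W) && _]andbC. Qed.

Lemma complete_rel_free W z : is_free (complete_rel W) z.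
Proof. by move=> u w /and3P [_ _ uW] /and3P [_ _ wW] uw; rewrite /complete_rel uw uW. Qed.

Lemma complete_xregular W z : xregular k (complete_rel W) z.
Proof.
exact: free_xregular (@complete_rel_irr W) (@complete_rel_sym W) (@complete_rel_free W z).
Qed.

Definition qset r (q : 'I_r -> V) : {set V} := [set q i | i : 'I_r].

Lemma in_qset r (q : 'I_r -> V) i : q i \in qset q.
Proof. exact: imset_f. Qed.

Local Notation KI q := (edge_ideal (complete_rel (qset q))).

(** With X and Y the combinations of the [x (q i)] and of the [y (q i)], the sum of minors is
    [x v * Y - y v * X]. If X is in the ideal, so is Y by [edge_ideal_xy]. Conversely, the minor of
    [q ord0] and [v] multiplies X into the ideal, and this minor is regular because [v] is a new
    vertex. *)
Lemma complete_relations r (q : 'I_r -> V) v (w : 'rV[S]_r) :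
  v \notin (qset q) ->
  KI q (\sum_(i < r) w ord0 i * minor v (q i)) <-> KI q (\sum_i w ord0 i * x (q i)).
Proof.
case: r q w => [|r] q w vW; first by rewrite !big_ord0.
have II := span_ideal (edge_gen (k := k) (complete_rel (qset q))).
have [I0 ID IM] := II; rewrite -/(edge_ideal _) in II I0 ID IM.
set X := \sum_i _ * x (q i); pose Y := \sum_i w ord0 i * y (q i).
have -> : \sum_i w ord0 i * minor v (q i) = x v * Y - y v * X.
  by rewrite !mulr_sumr -sumrB; apply: eq_bigr => i _; rewrite /edge_minor; ring.
have inW := in_qset q.
have adj j : q j != q ord0 -> complete_rel (qset q) (q ord0) (q j).
  by move=> ne; rewrite /complete_rel eq_sym ne !inW.
split=> [IXY|IX]; last first.
  apply: (idealB II); last exact: IM.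
  by apply/IM/(edge_ideal_xy (i := q ord0)) => // [j _|]; [exact: adj | exact: complete_xregular].
apply: (@minor_regular _ _ _ (q ord0) v _ _ (@complete_xregular _ _)).
- by apply: contraNneq vW => <-.
- by move=> u; rewrite /complete_rel (negbTE vW) !andbF.
set a := q ord0 in adj *.
have -> : minor a v * X = x v * (x a * Y - y a * X) - x a * (x v * Y - y v * X).
  by rewrite /edge_minor; ring.
apply: (idealB II); last exact: IM.
apply: (IM).
have -> : x a * Y - y a * X = \sum_i w ord0 i * minor a (q i).
  by rewrite !mulr_sumr -sumrB; apply: eq_bigr => i _; rewrite /edge_minor; ring.
apply: (ideal_sum _ II) => j _; apply: IM; case: (eqVneq (q j) a) => [->|ja].
  by rewrite minorxx.
exact: edge_ideal_minor (adj _ ja).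
Qed.

(* Eagon-Northcott: the columns [q] are added one at a time. The quotient of two
   successive ideals is presented by the relations between the [x (q i)] modulo
   the smaller ideal, which are resolved from the Koszul complex and from the
   resolution of the smaller ideal. *)
Lemma complete_linear r (q : 'I_r -> V) : injective q ->
  exists g (G : 'M[S]_(g, 1)),
  [/\ hmx (fun=> 2) (fun=> 0) G,
      forall v : 'rV[S]_1, (exists w, v = w *m G) <-> KI q (v ord0 ord0),
      has_linear_resolution 2 (fun w => w *m G = 0)
    & (2 <= r)%N -> (0 < g)%N].
Proof.
elim: r q => [|r IH] q inj_q.
  exists 0, 0; split=> //; first by case.
    move=> v; split=> [[w ->]|].
      by rewrite mulmx0 mxE; case: (span_ideal (edge_gen (k := k) (complete_rel (qset q)))).
    case=> n [c [g [hg Ev]]]; exists 0; apply/rowP => i.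
    rewrite mul0mx (ord1 i) Ev !mxE big1 // => j _.
    by case: (hg j) => u [w [/and3P [_ /imsetP [[]]]]].
  by apply: linear_resolution0; rewrite mul0mx.
set q' := fun i => q (lift ord0 i).
have inj_q' : injective q' by move=> i j /inj_q /lift_inj.
have inq' i : q' i \in qset q by apply: in_qset.
have q0 : q ord0 \notin (qset q').
  by apply/imsetP => -[i _ /inj_q /eqP]; rewrite (negbTE (neq_lift _ _)).
have [g [G [hG KG rG gr]]] := IH _ inj_q'.
have [h' hh' Gh'] : exists2 L, hmx (fun=> 2) (fun=> 1) L & G = L *m xcol q'.
  apply: hmx_lift hG (@xcol_hmx _ q' 0) _ => w; apply/col_span.
  have : KI q' ((w *m G) ord0 ord0) by apply/KG; exists w.
  have [I0 ID IM] := span_ideal (fun p => exists i, p = xcol q' i ord0).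
  apply: span_min (span_ideal _) _ _ => _ [u [v [/and3P [_ /imsetP [i _ ->] /imsetP [j _ ->]] ->]]].
  apply: (idealB (span_ideal _)); rewrite mulrC; apply: IM; apply: span_gen.
    by exists i; rewrite mxE.
  by exists j; rewrite mxE.
have [b [DB [hDB kerDB rDB]]] := linear_resolution_first (koszul_linear inj_q').
have rX : has_linear_resolution 1
    (fun w => KI q' (\sum_i w ord0 i * x (q' i))).
  (* The rows of [h'] and the Koszul relations [DB] generate the module in question. A combination
     of rows of [h'] is a Koszul relation exactly when the same combination of the generators [G]
     vanishes. *)
  have rC : has_linear_resolution 2 (fun w => w *m col_mx h' DB = 0).
    apply: (linear_resolution_ker_col hh' hDB) rDB.
    apply: linear_resolution_ext rG => w.
    by rewrite Gh' mulmxA; apply: kerDB.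
  apply: linear_resolution_ext (linear_resolution_im (hmx_col_const hh' hDB) rC) => v.
  have -> : \sum_i v ord0 i * x (q' i) = (v *m xcol q') ord0 ord0.
    by rewrite mxE; apply: eq_bigr => i _; rewrite mxE.
  rewrite -KG; split=> [[w ->]|[w Ew]].
    exists (lsubmx w); rewrite -{1}[w]hsubmxK mul_row_col mulmxDl Gh' mulmxA.
    suff -> : rsubmx w *m DB *m xcol q' = 0 by rewrite addr0.
    by apply/kerDB; exists (rsubmx w).
  have /kerDB [u Eu] : (v - w *m h') *m xcol q' = 0.
    by rewrite mulmxBl Ew Gh' mulmxA subrr.
  by exists (row_mx w u); rewrite mul_row_col -Eu addrC subrK.
pose h : 'M[S]_(r, 1) := \matrix_(i, j) minor (q ord0) (q' i).
have hh : hmx (fun=> 2) (fun=> 0) h by move=> i j; rewrite mxE; apply: hdeg_minor.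
exists (r + g)%N, (col_mx h G); split.
- exact: hmx_col_const hh hG.
- move=> v; split=> [[w ->]|].
    rewrite -[w]hsubmxK mul_row_col mxE.
    have II := span_ideal (edge_gen (k := k) (complete_rel (qset q))).
    have [I0 ID IM] := II; apply: ID.
      rewrite mxE; apply: (ideal_sum _ II) => i _; apply: IM; rewrite mxE.
      apply: edge_ideal_minor; rewrite /complete_rel (inj_eq inj_q) neq_lift.
      by rewrite in_qset inq'.
    have /KG : exists u, rsubmx w *m G = u *m G by exists (rsubmx w).
    apply: edge_ideal_sub => u v' /and3P [uv /imsetP [i _ Eu] /imsetP [j _ Ew]].
    by rewrite /complete_rel uv Eu Ew !inq'.
  move=> Kv; apply/col_span; move: Kv.
  have II := span_ideal (fun p => exists i, p = col_mx h G i ord0).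
  apply: (span_min II) => _ [u [w [/and3P [uw /imsetP [i _ Eu] /imsetP [j _ Ew]] ->]]].
  have top i0 : ideal_span (fun p => exists i, p = col_mx h G i ord0) (minor (q ord0) (q' i0)).
    by apply: span_gen; exists (lshift g i0); rewrite col_mxEu mxE.
  rewrite {}Eu {}Ew in uw *.
  case: (unliftP ord0 i) uw => [i'|] ->; case: (unliftP ord0 j) => [j'|] -> uw.
  + pose m : 'rV[S]_1 := const_mx (minor (q' i') (q' j')).
    have Km : KI q' (m ord0 ord0).
      by rewrite mxE; apply: edge_ideal_minor; rewrite /complete_rel uw !in_qset.
    have /col_span := (KG m).2 Km; rewrite mxE; apply: span_mono => _ [i0 ->].
    by exists (rshift r i0); rewrite col_mxEd.
  + by rewrite minorC; apply: (idealN II); apply: top.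
  + exact: top.
  + by rewrite eqxx in uw.
- apply: (linear_resolution_ker_col hh hG) rG.
  apply: linear_resolution_ext (linear_resolutionS rX) => w.
  rewrite -(complete_relations w q0).
  have -> : \sum_i w ord0 i * minor (q ord0) (q' i) = (w *m h) ord0 ord0.
    by rewrite mxE; apply: eq_bigr => i _; rewrite mxE.
  by rewrite -KG.
- by rewrite ltnS addn_gt0 => ->.
Qed.
End CompleteGraph.

(** * Adjoining a regular element *)

Section Adjoin.
Variables (k : fieldType) (N : nat).
Local Notation S := {mpoly k[N]}.

(* [beta] belongs to the resolution of the first syzygies of a module, or of an
   ideal inside [S]: its [i]-th term sits in homological degree [i.+1]. *)
Definition extremal (p : nat) (beta : nat -> nat -> Prop) : Prop :=
  (forall i j, beta i j -> (j <= p + 3 + i)%N) /\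
  (p = 0%N \/ beta p.-1 (p.*2 + 2)%N).

(** The degrees in a mapping cone. New generators have degree [4]: two for the adjoined quadric and
    two for the generators that it multiplies. *)
Definition adjoin_degrees (g : nat) (beta betaT : nat -> nat -> Prop) (i j : nat) : Prop :=
  beta i j \/
  if i is i'.+1 then exists2 j', betaT i' j' & j = (2 + j')%N
  else (0 < g)%N /\ j = 4.

(** The cone places [betaT] one homological step further and two degrees higher, so the bound and
    the corner both rise by one. For [p = 0] the corner comes from the new generators, whence
    [0 < g]. *)
Lemma extremal_adjoin p g beta betaT : (0 < g)%N ->
  extremal p beta -> extremal p betaT -> extremal p.+1 (adjoin_degrees g beta betaT).
Proof.
move=> g0 [ub _] [ubT topT]; split.
  move=> [|i] j; case=> [/ub|].
  - lia.
  - by case=> _ ->; lia.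
  - lia.
  - by case=> j' /ubT h ->; lia.
right; case: topT => [-> | topT] /=; right; first by [].
case: p topT {ub ubT} => [|p] topT //.
exists (p.+1.*2 + 2)%N; first exact: topT.
by rewrite -!muln2; lia.
Qed.

(** In a relation between the rows of [f *: h] and the generators of [Z], the coefficients of the
    former are the rows [w] with [w *m h] in [Z], since [f] cancels. This is the module that the
    second resolution resolves. *)
Lemma resolution_adjoin l g b (f : S) (s : 'I_b -> nat) (h : 'M[S]_(g, b))
    (Z : 'rV[S]_b -> Prop) beta betaT :
    f != 0 -> f@_0%MM = 0 -> (forall d, hdeg d d.+2 f) ->
    hmx (fun=> 2) s h ->
    (forall w : 'rV[S]_g, Z (f *: (w *m h)) -> Z (w *m h)) ->
  resolution true l s Z beta ->
  resolution true l (fun _ : 'I_g => 2) (fun w => Z (w *m h)) betaT ->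
  exists l', resolution true l' s (fun v => exists w, Z (v - f *: (w *m h)))
    (adjoin_degrees g beta betaT).
Proof.
move=> f0 f00 hf hh reg /resolutionS [b' [sB [D [hD mD ZD bD rD]]]] rT.
have hfh : hmx (shift_cat (fun _ : 'I_g => (2 + 2)%N) sB) s (col_mx (f *: h) D).
  apply: hmx_col hD => i j; rewrite mxE; apply: hdegM (hf 2) (hh i j).
have rA : resolution true l (fun _ : 'I_g => (2 + 2)%N)
    (fun w => exists u, w *m h = u *m D)
    (fun i j => exists2 j', betaT i j' & j = (2 + j')%N).
  by apply: resolution_ext (resolution_shift 2 rT) => // v; rewrite ZD.
have rK : resolution true l (shift_cat (fun _ : 'I_g => (2 + 2)%N) sB)
    (fun w => w *m col_mx (f *: h) D = 0)
    (fun i j => (exists2 j', betaT i j' & j = (2 + j')%N) \/ beta i.+1 j).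
  apply: (resolution_ker_col (e := 2) f0 _ hf hh hD _ _ rA rD) => //.
    by move=> w /ZD Zw; apply/ZD/reg.
  by move=> i j [j' _ ->].
exists l.+1; apply: resolution_ext (resolution_im hfh _ rK) => //.
- move=> v; split=> [[w ->]|[w /ZD [u Eu]]].
    exists (lsubmx w); apply/ZD; exists (rsubmx w).
    by rewrite -{1}[w]hsubmxK mul_row_col -scalemxAr addrC addKr.
  exists (row_mx w u); rewrite mul_row_col -Eu -scalemxAr addrC; exact/esym/subrK.
- move=> [|i] j; rewrite /adjoin_degrees.
    rewrite ex_shift_cat bD; split=> [[[i <-]|]|[|[g0 ->]]]; [right | by left | by right | left].
      by split=> //; case: g i {h hh reg rT hfh rA rK} => [[]|].
    by exists (Ordinal g0).
  by split=> [[]|[]]; [right | left | right | left].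
- move=> _ i j; rewrite mxE; case: split => i0; last exact: mD.
  by rewrite mxE rmorphM /= f00 mul0r.
Qed.

(** The recursive form suits induction on the length, while [graded_resolution] asks for sequences
    over all natural numbers; past the end the ranks are zero. *)
Lemma resolution_sequences l b (s : 'I_b -> nat) Z beta :
  resolution true l s Z beta ->
  exists rk (sh : forall i, 'I_(rk i) -> nat) (D0 : 'M[S]_(rk 0%N, b))
    (D : forall i, 'M[S]_(rk i.+1, rk i)),
  [/\ [/\ hmx (sh 0%N) s D0, forall i j, (D0 i j)@_0%MM = 0 &
        forall v, Z v <-> exists w, v = w *m D0],
      forall i, hmx (sh i.+1) (sh i) (D i),
      forall i a c, (D i a c)@_0%MM = 0,
      (forall v : 'rV[S]_(rk 0%N), v *m D0 = 0 <-> exists w, v = w *m D 0%N) /\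
      (forall i (v : 'rV[S]_(rk i.+1)), v *m D i = 0 <-> exists w, v = w *m D i.+1)
    & forall i j, beta i j <-> exists a, sh i a = j].
Proof.
elim: l b s Z beta => [|l IH] b s Z beta.
  case=> hZ hb; exists (fun=> 0%N), (fun _ _ => 0%N), 0, (fun=> 0).
  have V0 (v : 'rV[S]_0) : v = 0 by apply/rowP; case.
  split.
  - split; [by case | by case | move=> v; rewrite hZ].
    by split=> [->|[w ->]]; [exists 0|]; rewrite mulmx0.
  - by move=> i; case.
  - by move=> i; case.
  - by split=> [v|i v]; (split=> _; [exists 0; exact: etrans (V0 _) (esym (V0 _))|]);
      rewrite mulmx0.
  - by move=> i j; split=> [/hb // | [[]]].
case=> a [s' [D [hD mD ZD bD /IH]]].
move=> [rk [sh [D0 [Ds [[hD0 mD0 ZD0] hDs mDs [eD0 eDs] bDs]]]]].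
exists (fun i => if i is i'.+1 then rk i' else a).
exists (fun i => match i return 'I_(if i is i'.+1 then rk i' else a) -> nat with
  0%N => s' | i'.+1 => sh i' end).
exists D.
exists (fun i => match i return 'M[S]_(rk i, if i is i'.+1 then rk i' else a) with
  0%N => D0 | i'.+1 => Ds i' end).
split.
- by split=> //; apply: mD.
- by case=> [|i].
- by case=> [|i].
- by split=> //; case=> [|i] v.
- by case=> [|i] j; rewrite ?bD ?bDs.
Qed.

Lemma regularity_of_resolution (I : S -> Prop) l beta r :
  is_ideal I ->
  resolution true l (fun _ : 'I_1 => 0%N) (fun v => I (v ord0 ord0)) beta ->
  (forall i j, beta i j -> (j <= r + i.+1)%N) ->
  (exists i, beta i (r + i.+1)%N) ->
  regularity_quotient I r.
Proof.
move=> II /resolution_sequences.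
move=> [rk [sh [D0 [Ds [[hD0 mD0 ZD0] hDs mDs [eD0 eDs] bDs]]]]] ub [i0 top].
pose rk' i := if i is i'.+1 then rk i' else 1%N.
pose sh' i : 'I_(rk' i) -> nat :=
  match i return 'I_(rk' i) -> nat with 0%N => fun=> 0%N | i'.+1 => sh i' end.
pose Ds' i : 'M[S]_(rk' i.+1, rk' i) :=
  match i return 'M[S]_(rk i, rk' i) with 0%N => D0 | i'.+1 => Ds i' end.
have hD' i : hmx (sh' i.+1) (sh' i) (Ds' i) by case: i.
have eD' i (v : 'rV[S]_(rk' i.+1)) : v *m Ds' i = 0 <-> exists w, v = w *m Ds' i.+1.
  by case: i v => [|i] v; [apply: eD0 | apply: eDs].
pose one : 'cV[S]_1 := const_mx 1.
have aug_h a : one a ord0 \is (sh' 0%N a).-homog.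
  by rewrite mxE; apply: dhomog1.
have augE (v : 'rV[S]_1) : (v *m one) ord0 ord0 = v ord0 ord0.
  by rewrite mxE big_ord1 mxE mulr1.
have dif_h i a b : Ds' i a b != 0 ->
    (sh' i b <= sh' i.+1 a)%N /\ Ds' i a b \is (sh' i.+1 a - sh' i b)%N.-homog.
  exact: hdeg_homog (hD' i a b).
have surj (p : S) : exists v : 'rV[S]_(rk' 0%N), I (p - (v *m one) ord0 ord0).
  exists (const_mx p); rewrite augE mxE subrr; by case: II.
have exact0 (v : 'rV[S]_(rk' 0%N)) :
    I ((v *m one) ord0 ord0) <-> exists w, v = w *m Ds' 0%N.
  by rewrite augE; apply: ZD0.
exists (@GradedResolution k N I rk' sh' one Ds' aug_h dif_h surj exact0 eD').
split=> /=.
- by move=> [|i] a b; [exact: mD0 | exact: mDs].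
- by move=> [|i] a //; apply: ub; apply/bDs; exists a.
- by have /bDs [a Ea] := top; exists i0.+1, a.
Qed.

End Adjoin.

(** * The intersection of J with the ideal of the edges adjoined so far *)

Section State.
Variables (k : fieldType) (V : finType).
Local Notation S := {mpoly k[#|V| + #|V|]}.
Local Notation minor := (edge_minor k).
Implicit Types (e : rel V) (p q : S).

Definition join_rel (e e' : rel V) : rel V := fun u v => e u v || e' u v.

Definition edge_rel (a b : V) : rel V :=
  fun u v => (u == a) && (v == b) || (u == b) && (v == a).

Lemma edge_ideal_join_rel e e' p : edge_ideal (join_rel e e') p ->
  exists q r, [/\ edge_ideal e q, edge_ideal e' r & p = q + r].
Proof.
have [I0 ID IM] := span_ideal (edge_gen (k := k) e).
have [I0' ID' IM'] := span_ideal (edge_gen (k := k) e').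
move: p; apply: span_add_ind => [|_ _ [q [r [eq er ->]]] [q' [r' [eq' er' ->]]]|].
- by exists 0, 0; split; rewrite ?addr0.
- by exists (q + q'), (r + r'); split; [exact: ID | exact: ID' | rewrite addrACA].
move=> c _ [u [v [/orP [uv|uv] ->]]].
  by exists (c * minor u v), 0; split=> //; rewrite ?addr0 //; apply/IM/edge_ideal_minor.
by exists 0, (c * minor u v); split=> //; rewrite ?add0r //; apply/IM'/edge_ideal_minor.
Qed.

Lemma edge_ideal_join_rell e e' p : edge_ideal e p -> edge_ideal (join_rel e e') p.
Proof. by apply: edge_ideal_sub => u v uv; rewrite /join_rel uv. Qed.

Lemma edge_ideal_join_relr e e' p : edge_ideal e' p -> edge_ideal (join_rel e e') p.
Proof. by apply: edge_ideal_sub => u v uv; rewrite /join_rel uv orbT. Qed.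

Lemma edge_ideal_edge a b p : edge_ideal (edge_rel a b) p -> exists c, p = minor a b * c.
Proof.
move: p; apply: span_add_ind => [|_ _ [c ->] [d ->]|c _ [u [v [uv ->]]]].
- by exists 0; rewrite mulr0.
- by exists (c + d); rewrite mulrDr.
case/orP: uv => /andP [/eqP -> /eqP ->]; first by exists c; rewrite mulrC.
by exists (- c); rewrite minorC !mulrN mulrC.
Qed.

Lemma minor_neq0 (a b : V) : a != b -> minor a b != 0.
Proof.
move=> ab; apply: contraTneq isT => m0.
have : xvar k a * yvar k b = 0.
  have := congr1 (kill (lshift #|V| (enum_rank b))) m0.
  rewrite killB !killM kill0 !killx_x !killx_y eqxx (negbTE ab) mul0r subr0.
  by [].
by move/eqP; rewrite mulf_eq0 !(negbTE (mvar_neq0 _ _)).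
Qed.

Lemma minor_coef0 (a b : V) : (minor a b)@_0%MM = 0.
Proof. exact: hdeg_coef0 (@hdeg_minor k V 0 a b) _. Qed.

Variables (eK : rel V) (g : nat) (G : 'M[S]_(g, 1)).
Hypothesis hG : hmx (fun=> 2) (fun=> 0%N) G.
Hypothesis GK : forall v : 'rV[S]_1, (exists w, v = w *m G) <-> edge_ideal eK (v ord0 ord0).
Hypothesis rG : has_linear_resolution 2 (fun w => w *m G = 0).

Local Notation J := (edge_ideal (k := k) eK).

Definition meet_ideal e : S -> Prop := fun p => edge_ideal e p /\ J p.

Lemma meet_ideal_ideal e : is_ideal (meet_ideal e).
Proof.
have [I0 ID IM] := span_ideal (edge_gen (k := k) e).
have [J0 JD JM] := span_ideal (edge_gen (k := k) eK).
split.
- by split.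
- by move=> p q [Ip Jp] [Iq Jq]; split; [exact: ID | exact: JD].
- by move=> c p [Ip Jp]; split; [exact: IM | exact: JM].
Qed.

Lemma GJ (w : 'rV[S]_g) : J ((w *m G) ord0 ord0).
Proof. by apply/GK; exists w. Qed.

(* The ideal of [e] meets [J] in its product with [J]; the resolutions are those
   of this intersection inside [S] and of its preimage among the combinations of
   the generators of [J]. *)
Definition resolved (p : nat) e : Prop :=
  (forall q, meet_ideal e q -> ideal_mul (edge_ideal e) J q) /\
  exists l betaU betaT,
  [/\ resolution true l (fun _ : 'I_1 => 0%N) (fun v => meet_ideal e (v ord0 ord0)) betaU,
      resolution true l (fun _ : 'I_g => 2)
        (fun w => meet_ideal e ((w *m G) ord0 ord0)) betaT,
      extremal p betaU & extremal p betaT].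

Lemma edge_ideal_pred0 e p : e =2 (fun _ _ => false) -> edge_ideal e p -> p = 0.
Proof.
move=> e0; move: p; apply: (span_add_ind (P := fun p => p = 0))
  => [//|p1 p2 -> ->|c p [u [v [uv _]]]].
  by rewrite addr0.
by rewrite e0 in uv.
Qed.

Lemma resolved_ext n e e' : e =2 e' -> resolved n e -> resolved n e'.
Proof.
move=> ee'; have Ee q : edge_ideal e q <-> edge_ideal e' q.
  by split; apply: edge_ideal_sub => u v; rewrite ee'.
have Em q : meet_ideal e q <-> meet_ideal e' q.
  by rewrite /meet_ideal Ee.
case=> IFJ [l [bU [bT [rU rT xU xT]]]]; split.
  move=> q /Em /IFJ; apply: span_mono => _ [a [b [Fa Jb ->]]].
  by exists a, b; split=> //; apply/Ee.
by exists l, bU, bT; split=> //; [apply: resolution_ext rU | apply: resolution_ext rT].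
Qed.

(** Without edges the intersection is zero and its preimage is the module of syzygies of [G], linear
    from degree 3, which is the bound in [extremal 0]. *)
Lemma resolved0 e : e =2 (fun _ _ => false) -> resolved 0 e.
Proof.
move=> e0; split=> [q [/(edge_ideal_pred0 e0) -> _]|].
  by have [P0 _ _] := span_ideal (fun p => exists a b, [/\ edge_ideal e a, J b & p = a * b]).
have [l [beta [lb r]]] := rG.
have meet0 p : meet_ideal e p <-> p = 0.
  split=> [[/(edge_ideal_pred0 e0)] // | ->].
  by case: (meet_ideal_ideal e).
exists l, (fun _ _ => False), beta; split.
- apply: (@resolution_leq _ _ true 0) => //=; split=> [v|i j []]; rewrite meet0.
  split=> [v0 | ->]; last by rewrite mxE.
  by apply/rowP => i; rewrite !ord1 v0 mxE.
- apply: resolution_ext (resolution_linear_minimal _ lb r) => // w; rewrite meet0.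
  split=> [-> | w0]; first by rewrite mxE.
  by apply/rowP => i; rewrite !ord1 w0 mxE.
- by split; [|left].
- by split; [move=> i j /lb ->; lia | left].
Qed.

Lemma resolved_edge n e a b : (0 < g)%N -> a != b ->
    (forall q, edge_ideal e (minor a b * q) -> edge_ideal e q) ->
    (forall q, edge_ideal (join_rel eK e) (minor a b * q) -> edge_ideal (join_rel eK e) q) ->
  resolved n e -> resolved n.+1 (join_rel e (edge_rel a b)).
Proof.
move=> g_gt0 ab reg regK [IFJ [l [bU [bT [rU rT xU xT]]]]].
have IIe := span_ideal (edge_gen (k := k) e).
have [I0 ID IM] := meet_ideal_ideal e.
have [J0 JD JM] := span_ideal (edge_gen (k := k) eK).
have [F0 FD FM] := IIe.
(* Let [q0 + minor a b * d] lie in J with [q0] in the ideal of [e]. Regularity modulo the joined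
   ideal splits [d] into a member [c] of J and a member of the ideal of [e]; subtracting
   [minor a b * c] leaves an element of both ideals. *)
have FJ' q : meet_ideal (join_rel e (edge_rel a b)) q <->
    exists2 c, J c & meet_ideal e (q - minor a b * c).
  split; last first.
    case=> c Jc [Fq Jq]; split.
      rewrite -[q](subrK (minor a b * c)).
      have [_ FD' FM'] := span_ideal (edge_gen (k := k) (join_rel e (edge_rel a b))).
      apply: FD'; first exact: edge_ideal_join_rell.
      rewrite mulrC; apply: FM'; apply: edge_ideal_minor.
      by rewrite /join_rel /edge_rel !eqxx orbT.
    by rewrite -[q](subrK (minor a b * c)); apply: JD => //; apply: JM.
  case=> /edge_ideal_join_rel [q0 [r [Fq0 /edge_ideal_edge [d ->] ->]]] Jq.
  have : edge_ideal (join_rel eK e) (minor a b * d).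
    rewrite -[_ * d](addKr q0) addrC; apply: idealB (span_ideal _) _ _.
      exact: edge_ideal_join_rell Jq.
    exact: edge_ideal_join_relr Fq0.
  case/regK/edge_ideal_join_rel => c [q1 [Jc Fq1 Ed]]; exists c => //.
  have E : q0 + minor a b * d - minor a b * c = q0 + minor a b * q1.
    by rewrite Ed mulrDr addrA [q0 + _ + _]addrAC addrK.
  split; last by apply: idealB (span_ideal _) Jq _; apply: JM.
  by rewrite E; apply: FD => //; apply: FM.
have regJ q : J q -> meet_ideal e (minor a b * q) -> meet_ideal e q.
  by move=> Jq [/reg Fq _].
split.
  move=> q /FJ' [c Jc /IFJ].
  have [_ PD PM] := span_ideal (fun p => exists a0 b0,
    [/\ edge_ideal (join_rel e (edge_rel a b)) a0, J b0 & p = a0 * b0]).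
  move=> Iq; rewrite -[q](subrK (minor a b * c)); apply: PD.
    apply: span_mono Iq => _ [a0 [b0 [Fa Jb ->]]]; exists a0, b0; split=> //.
    exact: edge_ideal_join_rell.
  apply: span_gen; exists (minor a b), c; split=> //; apply: edge_ideal_minor.
  by rewrite /join_rel /edge_rel !eqxx orbT.
have fZ (w : 'rV[S]_g) : (minor a b *: w *m G) ord0 ord0 = minor a b * (w *m G) ord0 ord0.
  by rewrite -scalemxAl [LHS]mxE.
have regZ (w : 'rV[S]_g) : meet_ideal e ((minor a b *: (w *m G)) ord0 ord0) ->
    meet_ideal e ((w *m G) ord0 ord0).
  by rewrite scalemxAl fZ; apply/regJ/GJ.
have [l1 r1] := resolution_adjoin (minor_neq0 ab) (minor_coef0 a b)
  (fun d => @hdeg_minor k V d a b) hG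
  (Z := fun v => meet_ideal e (v ord0 ord0))
  regZ rU rT.
(* The preimage grows by the binomial times the whole free module, so [h] is the identity here and
   the coefficient rows form the old preimage again. *)
have h1 : hmx (fun _ : 'I_g => 2) (fun _ : 'I_g => 2) (1%:M : 'M[S]_g).
  move=> i j; rewrite mxE; case: (i == j); last exact: hdeg0.
  by rewrite mulr1n -mpolyC1; apply: hdegC.
have rT' : resolution true l (fun _ : 'I_g => 2)
    (fun w => meet_ideal e (((w *m 1%:M : 'rV_g) *m G) ord0 ord0)) bT.
  by apply: resolution_ext rT => // w; rewrite mulmx1.
have [|l2 r2] := resolution_adjoin (minor_neq0 ab) (minor_coef0 a b)
  (fun d => @hdeg_minor k V d a b) h1 _ rT rT'.
  by move=> w; rewrite !mulmx1 fZ; apply/regJ/GJ.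
have GJ' c : J c -> exists w : 'rV[S]_g, c = (w *m G) ord0 ord0.
  by move=> Jc; have [|w Ew] := (GK (const_mx c)).2; [rewrite mxE | exists w; rewrite -Ew mxE].
exists (maxn l1 l2), (adjoin_degrees g bU bT), (adjoin_degrees g bT bT); split.
- have sub00 (v : 'rV[S]_1) w : (v - minor a b *: (w *m G)) ord0 ord0 =
      v ord0 ord0 - minor a b * (w *m G) ord0 ord0.
    by rewrite -fZ -scalemxAl [LHS]mxE [X in _ + X]mxE.
  apply: resolution_ext (resolution_leq (leq_maxl l1 l2) r1) => // v.
  rewrite FJ'; split=> [[w Iw]|[c Jc Ic]].
    exists ((w *m G) ord0 ord0); first exact: GJ.
    by rewrite sub00 in Iw.
  have [w Ew] := GJ' _ Jc.
  by exists w; rewrite sub00 -Ew.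
- apply: resolution_ext (resolution_leq (leq_maxr l1 l2) r2) => // v.
  have D w : ((v - minor a b *: (w *m 1%:M)) *m G) ord0 ord0 =
      (v *m G) ord0 ord0 - minor a b * (w *m G) ord0 ord0.
    by rewrite mulmx1 mulmxBl -fZ [LHS]mxE [X in _ + X]mxE.
  rewrite FJ'; split=> [[w]|[c Jc Ic]].
    by rewrite D => Iw; exists ((w *m G) ord0 ord0) => //; apply: GJ.
  have [w Ew] := GJ' _ Jc.
  by exists w; rewrite D -Ew.
- exact: extremal_adjoin.
- exact: extremal_adjoin.
Qed.

Lemma resolved_regularity n e (I : S -> Prop) : (0 < n)%N -> resolved n e ->
  is_ideal I -> (forall q, I q <-> ideal_mul (edge_ideal e) J q) ->
  regularity_quotient I (2 + n).
Proof.
move=> n0 [IFJ [l [bU [_ [rU _ [ub top] _]]]]] II EI.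
have E q : meet_ideal e q <-> ideal_mul (edge_ideal e) J q.
  split; first exact: IFJ.
  move: q; apply: span_min (meet_ideal_ideal e) _ => _ [a [b [Fa Jb ->]]].
  have [_ _ FM] := span_ideal (edge_gen (k := k) e).
  have [_ _ JM] := span_ideal (edge_gen (k := k) eK).
  by split; [rewrite mulrC; apply: FM | apply: JM].
have rI : resolution true l (fun _ : 'I_1 => 0%N)
    (fun v => I (v ord0 ord0)) bU.
  by apply: resolution_ext rU => // v; rewrite EI; apply: E.
apply: (regularity_of_resolution II rI).
- by move=> i j /ub; lia.
- case: top => [nE | top]; first by rewrite nE in n0.
  (* The corner of degree [2n + 2] sits in homological degree [n] of the quotient, which gives
     [n + 2]. *)
  exists n.-1; have -> : (2 + n + n.-1.+1 = n.*2 + 2)%N by rewrite -muln2; lia.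
  exact: top.
Qed.

End State.

(** * Paths *)

Section Paths.
Variable V : finType.
Implicit Types (e : rel V) (v w : V) (p : seq V) (ps : seq (V * seq V)).

(* A path is encoded by its first vertex [v] and the list [p] of the others. *)
Definition path_rel v p : rel V := fun u w =>
  ((u, w) \in zip (v :: p) p) || ((w, u) \in zip (v :: p) p).

Definition paths_rel ps : rel V := fun u w => has (fun c => path_rel c.1 c.2 u w) ps.

Lemma path_rel_cons v w p :
  path_rel v (w :: p) =2 join_rel (edge_rel v w) (path_rel w p).
Proof.
move=> a b; rewrite /path_rel /join_rel /edge_rel /= !inE !xpair_eqE.
rewrite [(b == v) && _]andbC !orbA; congr (_ || _); rewrite -!orbA; congr (_ || _).
exact: orbC.
Qed.

Lemma mem_zip_path v p a b : (a, b) \in zip (v :: p) p -> a \in v :: p /\ b \in p.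
Proof.
elim: p v => [//|w p IH] v; rewrite /= inE xpair_eqE => /orP [/andP [/eqP -> /eqP ->]|].
  by rewrite !mem_head.
by case/IH => ap bp; rewrite in_cons ap orbT in_cons bp orbT.
Qed.

Lemma path_rel_mem v p a b : path_rel v p a b -> a \in v :: p /\ b \in v :: p.
Proof.
by case/orP=> /mem_zip_path [ha hb]; split=> //; rewrite in_cons (ha, hb) orbT.
Qed.

Lemma path_rel_sym v p : ssrbool.symmetric (path_rel v p).
Proof. by move=> a b; rewrite /path_rel orbC. Qed.

Lemma path_rel_irr v p : uniq (v :: p) -> irreflexive (path_rel v p).
Proof.
elim: p v => [//|w p IH] v /andP [vp up] a; rewrite path_rel_cons /join_rel; rewrite (IH w up).
rewrite orbF /edge_rel; apply/negP => h.
have E : v = w by case/orP: h => /andP [/eqP <- /eqP <-].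
by rewrite E mem_head in vp.
Qed.

(** By [free_xregular] and [minor_regular] this makes the binomial of the next edge of the path
    regular, and it passes on to the next vertex. *)
Definition attachable e v p : Prop :=
  [/\ irreflexive e, ssrbool.symmetric e, is_free e v & forall w, w \in p -> isolated e w].

(** The new end [w] has [v] as its only neighbour, hence is free. *)
Lemma attachable_cons e v w p : uniq [:: v, w & p] -> attachable e v (w :: p) ->
  attachable (join_rel e (edge_rel v w)) w p.
Proof.
rewrite /= inE negb_or -andbA => /and4P [vw vp wp _] [irr sym _ iso].
have isow : isolated e w by apply: iso; rewrite mem_head.
split.
- move=> a; rewrite /join_rel irr /= /edge_rel; apply/negP => h.
  have E : v = w by case/orP: h => /andP [/eqP <- /eqP <-].
  by rewrite E eqxx in vw.
- by move=> a b; rewrite /join_rel sym /edge_rel orbC [(b == v) && _]andbC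
    [(b == w) && _]andbC orbC [_ && _ || _]orbC.
- have N a : join_rel e (edge_rel v w) w a -> a = v.
    rewrite /join_rel (negbTE (proj2 (isow a))) /edge_rel eqxx eq_sym (negbTE vw) /=.
    by move/eqP.
  by move=> a b /N -> /N ->; rewrite eqxx.
- move=> a ap b; have [h1 h2] := iso a (mem_behead (s := w :: p) ap) b.
  have av : a != v by apply: contraNneq vp => <-.
  have aw : a != w by apply: contraNneq wp => <-.
  by rewrite /join_rel (negbTE h1) (negbTE h2) /edge_rel (negbTE av) (negbTE aw) !andbF.
Qed.

Lemma attachable_join_rel e r v p : irreflexive r -> ssrbool.symmetric r ->
  (forall a b, r a b -> a \notin v :: p) -> attachable e v p ->
  attachable (join_rel e r) v p.
Proof.
move=> rirr rsym rvp [irr sym fv iso]; split.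
- by move=> a; rewrite /join_rel irr rirr.
- by move=> a b; rewrite /join_rel sym rsym.
- have N a : join_rel e r v a -> e v a.
    by case/orP => // /rvp; rewrite mem_head.
  by move=> a b /N va /N vb ab; rewrite /join_rel fv.
- move=> w wp u; have [h1 h2] := iso w wp u.
  have h a : ~~ r w a by apply/negP => /rvp; rewrite in_cons wp orbT.
  by rewrite /join_rel (negbTE h1) (negbTE h2) (negbTE (h u)) rsym (negbTE (h u)).
Qed.

(** * Counting the edges of disjoint paths *)

Lemma uniq_edge_sets v p : uniq (v :: p) ->
  uniq [seq [set c.1; c.2] | c <- zip (v :: p) p].
Proof.
elim: p v => [//|w p IH] v /andP [vp up]; rewrite /= in IH *; rewrite IH // andbT.
apply/mapP => -[[a b] /mem_zip_path [ap bp] /setP /(_ v)].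
rewrite !inE eqxx /= => /esym /orP [] /eqP E; rewrite E in vp.
  by rewrite ap in vp.
by rewrite in_cons bp orbT in vp.
Qed.

Definition paths_vertices ps := flatten [seq c.1 :: c.2 | c <- ps].

Definition paths_edges ps : seq {set V} :=
  flatten [seq [seq [set d.1; d.2] | d <- zip (c.1 :: c.2) c.2] | c <- ps].

Lemma paths_vertices_cons c ps :
  paths_vertices (c :: ps) = (c.1 :: c.2) ++ paths_vertices ps.
Proof. by []. Qed.

Lemma paths_edges_cons c ps : paths_edges (c :: ps) =
  [seq [set d.1; d.2] | d <- zip (c.1 :: c.2) c.2] ++ paths_edges ps.
Proof. by []. Qed.

Lemma uniq_paths_edges ps : uniq (paths_vertices ps) -> uniq (paths_edges ps).
Proof.
elim: ps => [//|[v p] ps IH]; rewrite paths_vertices_cons paths_edges_cons !cat_uniq.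
move=> /and3P [uvp disj /IH ->]; rewrite (uniq_edge_sets uvp) andbT /=.
apply/hasPn => A /flattenP [_ /mapP [c cps ->] /mapP [[a b] /mem_zip_path [ac bc] ->]].
apply/mapP => -[[a' b'] /mem_zip_path [ap bp] /setP /(_ a)].
rewrite !inE eqxx /= => /esym aE.
have ain : a \in v :: p.
  by case/orP: aE => /eqP ->; rewrite // in_cons bp orbT.
move/hasPn: disj => /(_ a); rewrite ain => /(_ _) /negP; apply => //.
by apply/flattenP; exists (c.1 :: c.2) => //; apply: map_f.
Qed.

Lemma size_paths_edges ps : size (paths_edges ps) = (\sum_(c <- ps) size c.2)%N.
Proof.
elim: ps => [|[v p] ps IH]; first by rewrite big_nil.
rewrite big_cons -IH /paths_edges /= size_cat size_map size_zip /=.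
by rewrite minnC (minn_idPl (leqnSn _)).
Qed.

Lemma mem_paths_edges ps A :
  A \in paths_edges ps <-> exists2 c, paths_rel ps c.1 c.2 & A = [set c.1; c.2].
Proof.
split.
  case/flattenP => _ /mapP [c cps ->] /mapP [d dc ->]; exists d => //.
  by apply/hasP; exists c => //; rewrite /path_rel -surjective_pairing dc.
case=> [[a b] /= /hasP [c cps /orP [] h] ->]; apply/flattenP;
  (exists [seq [set d.1; d.2] | d <- zip (c.1 :: c.2) c.2]; first exact: map_f).
  by apply/mapP; exists (a, b).
by apply/mapP; exists (b, a); rewrite //= setUC.
Qed.

Lemma mem_zip_behead (x0 : V) s a b : (a, b) \in zip s (behead s) <->
  exists j, [/\ (j.+1 < size s)%N, a = nth x0 s j & b = nth x0 s j.+1].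
Proof.
have sz : size (zip s (behead s)) = (size s).-1.
  by rewrite size_zip size_behead; apply/minn_idPr/leq_pred.
split.
  case/(nthP (x0, x0)) => j; rewrite sz => js.
  rewrite nth_zip_cond sz js nth_behead => -[<- <-].
  by exists j; split=> //; case: (size s) js.
case=> j [js -> ->]; apply/(nthP (x0, x0)); exists j.
  by rewrite sz; case: (size s) js.
by rewrite nth_zip_cond sz nth_behead ifT //; case: (size s) js.
Qed.

(** * A single path and its free vertices *)

Section OnePath.
Variables (r : nat) (f : 'I_r.+1 -> V) (A : sgraph V).
Hypothesis inj_f : injective f.
Hypothesis vertA : vert A = [set f i | i : 'I_r.+1].
Hypothesis adjA : forall i j : 'I_r.+1,
  adj A (f i) (f j) = (i.+1 == j :> nat) || (j.+1 == i :> nat).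

Lemma path_of_fun : exists p,
  [/\ uniq (f ord0 :: p), vert A =i f ord0 :: p & adj A =2 path_rel (f ord0) p].
Proof.
pose p := [seq f (lift ord0 j) | j <- enum 'I_r].
have E : f ord0 :: p = [seq f i | i <- enum 'I_r.+1].
  by rewrite enum_ordSl /= -map_comp.
have sz : size (f ord0 :: p) = r.+1 by rewrite E size_map size_enum_ord.
have nthE (i : 'I_r.+1) : nth (f ord0) (f ord0 :: p) i = f i.
  by rewrite E (nth_map i) ?size_enum_ord // nth_ord_enum.
have memE : vert A =i f ord0 :: p.
  move=> u; rewrite vertA E; apply/imsetP/mapP => -[i _ ->]; exists i => //.
  by rewrite mem_enum.
have zipE (i j : 'I_r.+1) : (f i, f j) \in zip (f ord0 :: p) p = (i.+1 == j :> nat).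
  apply/idP/eqP => [/(mem_zip_behead (f ord0) (f ord0 :: p)) [l [lr]]|ij].
    rewrite sz in lr; rewrite (nthE (Ordinal lr)) (nthE (Ordinal (ltnW lr))).
    by move=> /inj_f -> /inj_f ->.
  apply/(mem_zip_behead (f ord0) (f ord0 :: p)); exists i.
  by rewrite sz ij !nthE; split=> //; apply: ltn_ord.
exists p; split=> //.
  by rewrite E map_inj_uniq // enum_uniq.
have sub a b : (a \in vert A -> b \in vert A -> adj A a b = path_rel (f ord0) p a b) ->
    adj A a b = path_rel (f ord0) p a b.
  move=> h; apply/idP/idP => ab.
    by rewrite -h //; [exact: adj_vert ab | rewrite adj_sym in ab; exact: adj_vert ab].
  by have [ha hb] := path_rel_mem ab; rewrite h ?memE.
move=> a b; apply: sub; rewrite vertA => /imsetP [i _ ->] /imsetP [j _ ->].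
by rewrite adjA /path_rel !zipE.
Qed.

Lemma edge_clique (i j : 'I_r.+1) : i.+1 = j -> clique A [set f i; f j].
Proof.
move=> ij; apply/andP; split.
  by apply/subsetP => u; rewrite !inE vertA => /orP [] /eqP ->; apply: imset_f.
apply/forall_inP => u; rewrite !inE => hu; apply/forall_inP => w; rewrite !inE => hw.
apply/implyP => uw; case/orP: hu uw => /eqP ->; case/orP: hw => /eqP ->;
  by rewrite ?eqxx ?adjA ?ij ?eqxx ?orbT.
Qed.

(* An inner vertex lies in the maximal cliques around both of its edges. *)
Lemma free_vertex_end (i : 'I_r.+1) : free_vertex A (f i) ->
  i = ord0 \/ i = ord_max.
Proof.
move=> fr; case: (posnP i) => [i0|ipos]; first by left; apply: val_inj.
case: (ltnP i r) => ir; last first.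
  by right; apply: val_inj; apply/eqP; rewrite eqn_leq ir -ltnS ltn_ord.
have ip : (i.-1 < r.+1)%N by apply: leq_ltn_trans (leq_pred _) (ltn_ord i).
have is1 : (i.+1 < r.+1)%N by [].
pose a : 'I_r.+1 := Ordinal ip; pose b : 'I_r.+1 := Ordinal is1.
have [C1 m1 s1] := maxset_exists (@edge_clique a i (prednK ipos)).
have [C2 m2 s2] := maxset_exists (@edge_clique i b erefl).
move: fr => /cards1P [C0 E].
have [e1 e2] : C1 = C0 /\ C2 = C0.
  by split; apply/set1P; rewrite -E inE ?m1 ?m2 /=;
    [apply: (subsetP s1) | apply: (subsetP s2)]; rewrite !inE eqxx ?orbT.
have /andP [_ /forall_inP cl] := maxsetp m1.
have aC : f a \in C1 by apply: (subsetP s1); rewrite !inE eqxx.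
have bC : f b \in C1 by rewrite e1 -e2; apply: (subsetP s2); rewrite !inE eqxx orbT.
have /forall_inP /(_ _ bC) /implyP := cl _ aC.
rewrite (inj_eq inj_f) adjA /= prednK // => /(_ _) h.
have ab : a != b by rewrite -val_eqE /= neq_ltn prednK // leqnSn.
by move: (h ab); rewrite eqn_leq ltnn andbF /= eqn_leq; lia.
Qed.
End OnePath.

(** Orients the path outwards from [U]: a shared vertex is free, hence an end, and the listing
    starts there. *)
Lemma path_from A (U : {set V}) : is_path A ->
  (U :&: vert A != set0 -> exists2 v, U :&: vert A = [set v] & free_vertex A v) ->
  exists c : V * seq V, [/\ uniq (c.1 :: c.2), vert A =i c.1 :: c.2,
    adj A =2 path_rel c.1 c.2 & forall w, w \in c.2 -> w \notin U].
Proof.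
case=> r [f [inj_f vertA adjA]] hU.
have finish (h : 'I_r.+1 -> V) : injective h ->
    vert A = [set h i | i : 'I_r.+1] ->
    (forall i j : 'I_r.+1,
       adj A (h i) (h j) = (i.+1 == j :> nat) || (j.+1 == i :> nat)) ->
    (forall w, w \in U :&: vert A -> w = h ord0) ->
    exists c : V * seq V, [/\ uniq (c.1 :: c.2), vert A =i c.1 :: c.2,
      adj A =2 path_rel c.1 c.2 & forall w, w \in c.2 -> w \notin U].
  move=> inj_h vA aA hw; have [p [up vp ap]] := path_of_fun inj_h vA aA.
  exists (h ord0, p); split=> // w wp; apply/negP => wU.
  have wE : w = h ord0 by apply: hw; rewrite inE wU vp in_cons wp orbT.
  by move: up; rewrite /= -wE wp.
case: (eqVneq (U :&: vert A) set0) => [U0|/hU [v Ev fv]].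
  by apply: (finish f) => // w; rewrite U0 inE.
have /imsetP [i _ vi] : v \in [set f i | i : 'I_r.+1].
  by have := set11 v; rewrite -Ev inE vertA => /andP [].
rewrite vi in fv.
case: (free_vertex_end inj_f vertA adjA fv) => Ei.
  by apply: (finish f) => // w; rewrite Ev => /set1P ->; rewrite vi Ei.
(* The shared vertex is the last one, so the numbering is reversed. *)
apply: (finish (f \o @rev_ord r.+1)).
- exact: inj_comp inj_f rev_ord_inj.
- rewrite vertA; apply/setP => u; apply/imsetP/imsetP => -[j _ ->].
    by exists (rev_ord j); rewrite //= rev_ordK.
  by exists (rev_ord j).
- move=> a b; rewrite adjA /= orbC; have := ltn_ord a; have := ltn_ord b; lia.
- move=> w; rewrite Ev => /set1P ->; rewrite vi Ei /=; congr (f _).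
  by apply: val_inj; rewrite /= subn1.
Qed.
End Paths.

(** * Adjoining the paths edge by edge *)

Section PathsResolved.
Variables (k : fieldType) (V : finType).
Local Notation S := {mpoly k[#|V| + #|V|]}.
Local Notation minor := (edge_minor k).
Variables (eK : rel V) (g : nat) (G : 'M[S]_(g, 1)).
Hypothesis hG : hmx (fun=> 2) (fun=> 0%N) G.
Hypothesis GK : forall v : 'rV[S]_1, (exists w, v = w *m G) <-> edge_ideal eK (v ord0 ord0).
Hypothesis rG : has_linear_resolution 2 (fun w => w *m G = 0).
Hypothesis g_gt0 : (0 < g)%N.

(** Attachability is followed on two graphs: on [e] for regularity modulo the ideal of the edges so
    far, on [e'] for regularity modulo its sum with J. *)
Lemma resolved_path n e e' v p : uniq (v :: p) -> e' =2 join_rel eK e ->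
  attachable e v p -> attachable e' v p ->
  resolved eK G n e -> resolved eK G (n + size p) (join_rel e (path_rel v p)).
Proof.
elim: p v n e e' => [|w p IH] v n e e' uvp Ee' ae ae' re.
  by rewrite addn0; apply: resolved_ext re => a b; rewrite /join_rel /path_rel /= orbF.
have /andP [wp up] := uvp.
have vw : v != w by move: wp; rewrite inE negb_or => /andP [].
have Ee'q q : edge_ideal (join_rel eK e) q <-> edge_ideal e' q.
  by split; apply: edge_ideal_sub => a b; rewrite Ee'.
have reg e0 : attachable e0 v (w :: p) -> forall q,
    edge_ideal e0 (minor v w * q) -> edge_ideal e0 q.
  case=> irr sym fv iso; apply: minor_regular => //; last exact: free_xregular.
  by apply: iso; rewrite mem_head.
have r1 : resolved eK G n.+1 (join_rel e (edge_rel v w)).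
  apply: (resolved_edge hG GK g_gt0 vw (reg e ae)) re => q.
  by move/Ee'q/(reg _ ae')/Ee'q.
rewrite addnS -addSn.
apply: resolved_ext (IH w n.+1 _ (join_rel e' (edge_rel v w)) up _ _ _ r1).
- by move=> a b; rewrite /join_rel path_rel_cons /join_rel orbA.
- by move=> a b; rewrite /join_rel Ee' /join_rel orbA.
- exact: attachable_cons.
- exact: attachable_cons.
Qed.

Lemma resolved_paths n e e' ps : uniq (paths_vertices ps) -> e' =2 join_rel eK e ->
  (forall c, c \in ps -> attachable e c.1 c.2 /\ attachable e' c.1 c.2) ->
  resolved eK G n e ->
  resolved eK G (n + \sum_(c <- ps) size c.2) (join_rel e (paths_rel ps)).
Proof.
elim: ps n e e' => [|[v p] ps IH] n e e' ups Ee' att re.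
  by rewrite big_nil addn0; apply: resolved_ext re => a b; rewrite /join_rel orbF.
move: ups; rewrite paths_vertices_cons cat_uniq => /and3P [uvp disj ups].
have [ae ae'] := att (v, p) (mem_head _ _).
have r1 := resolved_path uvp Ee' ae ae' re.
rewrite big_cons addnA.
apply: resolved_ext (IH _ _ (join_rel e' (path_rel v p)) ups _ _ r1).
- by move=> a b; rewrite /join_rel -orbA.
- by move=> a b; rewrite /join_rel Ee' /join_rel orbA.
move=> c cps; have [|ac ac'] := att c; first by rewrite in_cons cps orbT.
have avoid a b : path_rel v p a b -> a \notin c.1 :: c.2.
  case/path_rel_mem => ap _; apply: contraL ap => ac0.
  move/hasPn: disj; apply; apply/flattenP; exists (c.1 :: c.2) => //.
  exact: map_f.
by split; apply: (attachable_join_rel (path_rel_irr uvp) (@path_rel_sym _ v p) avoid).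
Qed.
End PathsResolved.

Local Close Scope ring_scope.

Theorem theorem4p1 (k : fieldType) (V : finType) (t m n : nat)
    (P : 'I_t -> sgraph V) (K : sgraph V)
    (P_path : forall i, is_path (P i))
    (P_disj : forall i j : 'I_t, i != j -> [disjoint vert (P i) & vert (P j)])
    (K_complete : is_complete m K)
    (cond_a : forall i, vert K :&: vert (P i) != set0 ->
       exists2 v, vert K :&: vert (P i) = [set v] & free_vertex (P i) v)
    (cond_b : forall i j : 'I_t, i != j ->
       vert K :&: vert (P i) :&: vert (P j) = set0)
    (V_vert : vert (graph_union P) :|: vert K = [set: V])
    (n_edges : n = #|edges (graph_union P)|)
    (n_ge1 : 1 <= n) (m_ge2 : 2 <= m) :
  regularity_quotient
    (ideal_mul (binomial_edge_ideal k (graph_union P))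
               (binomial_edge_ideal k K))
    (2 + n).
Proof.
case: K_complete => cardK adjK.
have /fin_all_exists [c cP] := fun i => path_from (P_path i) (cond_a i).
pose ps := [seq c i | i <- enum 'I_t].
have adjP : adj (graph_union P) =2 paths_rel ps.
  move=> u w; apply/existsP/hasP => [[i uw]|[_ /mapP [i _ ->] uw]].
    exists (c i); first by apply: map_f; rewrite mem_enum.
    by case: (cP i) => _ _ <-.
  by exists i; case: (cP i) => _ _ ->.
have ups : uniq (paths_vertices ps).
  rewrite /ps; have := enum_uniq 'I_t.
  elim: (enum 'I_t) => [//|i s IH] /andP [is_ /IH us].
  rewrite map_cons paths_vertices_cons cat_uniq us andbT; case: (cP i) => -> vi _ _ /=.
  apply/hasPn => u /flattenP [_ /mapP [_ /mapP [j js ->] ->]] /=; case: (cP j) => _ vj _ _.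
  rewrite -vj -vi => uj; apply/negP => ui.
  have ij : i != j by apply: contraNneq is_ => ->.
  by have /disjoint_setI0/setP/(_ u) := P_disj i j ij; rewrite !inE ui uj.
have nE : n = (\sum_(d <- ps) size d.2)%N.
  rewrite n_edges -size_paths_edges -(card_uniqP (uniq_paths_edges ups)).
  apply: eq_card => A; apply/imsetP/idP.
    case=> d; rewrite inE => dd ->; apply/mem_paths_edges; exists d => //.
    by rewrite -adjP.
  by case/mem_paths_edges => d dd ->; exists d; rewrite // inE adjP.
pose q : 'I_#|vert K| -> V := enum_val.
have qK : qset q = vert K.
  apply/setP => u; apply/imsetP/idP => [[i _ ->]|uK]; first exact: enum_valP.
  by exists (enum_rank_in uK u); rewrite // /q enum_rankK_in.
have [g [G [hG GK rG g_gt0]]] := complete_linear k (@enum_val_inj _ (vert K) : injective q).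
have {}g_gt0 : (0 < g)%N by apply: g_gt0; rewrite cardK.
pose e0 : rel V := fun _ _ => false.
set eK := complete_rel (qset q) in GK.
have r0 : resolved eK G 0 e0 by apply: resolved0.
have rn : resolved eK G n (join_rel e0 (paths_rel ps)).
  rewrite nE; apply: (@resolved_paths _ _ _ _ _ hG GK g_gt0 0%N e0 eK) r0 => //.
    by move=> a b; rewrite /join_rel orbF.
  (* Only the first vertex of an oriented path can lie in [K], and every vertex is free for [eK], so
     each path attaches to it. *)
  move=> _ /mapP [i _ ->]; split; first by split.
  split; [exact: complete_rel_irr | exact: complete_rel_sym | exact: complete_rel_free |].
  move=> w wc; case: (cP i) => _ _ _ /(_ _ wc); rewrite -qK => /negbTE wK.
  by move=> u; rewrite /eK /complete_rel wK !andbF.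
apply: (resolved_regularity n_ge1 rn); first exact: span_ideal.
have adjKE : adj K =2 eK.
  move=> u w; rewrite /eK /complete_rel qK; apply/idP/and3P => [uw|[uw uK wK]].
    have uK := adj_vert uw; have wK : w \in vert K by rewrite adj_sym in uw; apply: adj_vert uw.
    by rewrite -adjK.
  by rewrite adjK.
have bE e (A : sgraph V) p : adj A =2 e -> binomial_edge_ideal k A p <-> edge_ideal e p.
  by move=> Ae; split; apply: edge_ideal_sub => u w; rewrite Ae.
have E1 := bE _ (graph_union P) _ (adjP : _ =2 join_rel e0 (paths_rel ps)).
have E2 := bE _ K _ adjKE.
by move=> p; split; apply: span_mono => _ [a [b [Ia Ib ->]]]; exists a, b;
  split=> //; [apply/E1 | apply/E2 | apply/E1 | apply/E2].
Qed.
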